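(* Let $r,p,s$ be positive integers such that $s$ and $p$ divide $r$, and let $d=sp/\gcd(sp,r)$. Then $$\Bigg\{\sum_{k_1,k_2\geq 0}t_1^{k_1}t_2^{k_2}\sum_{l=0}^{s-1}\bigg(\prod_{\substack{i\in[0,k_1\frac{r}{s}],\ j\in[0,k_2\frac{r}{s}]:\\ i+j\equiv l\frac{r}{s}\ \mathrm{mod}\ r}}\frac{1}{1-u\,a_1^{R_{r/s}(i)}a_2^{R_{r/s}(j)}q_1^{i}q_2^{j}}\bigg)\Bigg\}_{u^dq_1^p}$$ $$=\sum_{n\ge 0\,:\ d\mid n}u^n\,\frac{\sum_{g\in G(r,p,s,n)}t_1^{\mathrm{des}(g)}t_2^{\mathrm{des}(g^{-1})}q_1^{\mathrm{fmaj}(g)}q_2^{\mathrm{fmaj}(g^{-1})}a_1^{\mathrm{col}(g)}a_2^{\mathrm{col}(g^{-1})}}{(1-t_1)(1-t_2)(1-t_1q_1^{n\frac{r}{s}})(1-t_2q_2^{n\frac{r}{s}})\prod_{j=1}^{n-1}(1-t_1^sq_1^{jr})(1-t_2^sq_2^{jr})}.$$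
   Context: Notation. $[a,b]=\{a,a+1,\ldots,b\}$ for integers $a\le b$. For a positive integer $m$, $R_m(i)\in\{0,\ldots,m-1\}$ denotes the residue of $i\in\mathbb Z$ modulo $m$. The identity is one of formal power series in $u,t_1,t_2,q_1,q_2,a_1,a_2$. For a power series $F$, $\{F\}_{u^dq_1^p}$ is obtained from $F$ by discarding all terms whose degree in $u$ is not divisible by $d$ or whose degree in $q_1$ is not divisible by $p$. Groups. $G(r,n)$ is the group of pairs $(c_1,\ldots,c_n;\sigma)$ with $c_i\in\{0,\ldots,r-1\}$ (the colors) and $\sigma\in S_n$, with product $(d_1,\ldots,d_n;\tau)(c_1,\ldots,c_n;\sigma)=(R_r(c_1+d_{\sigma(1)}),\ldots,R_r(c_n+d_{\sigma(n)});\tau\sigma)$. For $p\mid r$, $G(r,p,n)$ is the subgroup of elements with $c_1+\cdots+c_n\equiv 0 \bmod p$. For $s\mid r$ with $ps\mid rn$, $C_s\subseteq G(r,p,n)$ is the cyclic subgroup of order $s$ generated by $(r/s,\ldots,r/s;\mathrm{id})$, and $G(r,p,s,n)=G(r,p,n)/C_s$. For fixed $r,p,s$ with $p\mid r$ and $s\mid r$, the condition $ps\mid rn$ says that $d=sp/\gcd(sp,r)$ divides $n$. Statistics. For $g\in G(r,p,s,n)$ represented by $(c_1,\ldots,c_n;\sigma)$ let $\mathrm{HDes}(g)=\{i\in\{1,\ldots,n-1\}: c_i=c_{i+1},\ \sigma(i)>\sigma(i+1)\}$, $h_i(g)=\#\{j\ge i: j\in\mathrm{HDes}(g)\}$, $k_n(g)=R_{r/s}(c_n)$,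 $k_i(g)=k_{i+1}(g)+R_r(c_i-c_{i+1})$ for $1\le i\le n-1$, $\lambda_i(g)=r\,h_i(g)+k_i(g)$. Then $\mathrm{fmaj}(g)=\sum_{i=1}^n\lambda_i(g)$, $\mathrm{des}(g)=\left\lfloor\frac{s\lambda_1(g)+r-s}{r}\right\rfloor$, $\mathrm{col}(g)=\sum_{i=1}^nR_{r/s}(c_i)$. These do not depend on the representative chosen.
   Formalization: The n=0 summand, where des is undefined and the displayed fraction read literally gives a false identity, is taken to be s/((1-t_1)(1-t_2)), the actual u^0 part of the left-hand side; all summands with n≥1 are as displayed. *)

(* Defs.v *)
From HB Require Import structures.
From mathcomp Require Import all_boot all_order all_algebra all_fingroup.
From mathcomp Require Import boolp classical_sets cardinality fsbigop.
From mathcomp Require Import mpoly.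

Set Implicit Arguments.
Unset Strict Implicit.
Unset Printing Implicit Defensive.

Import GRing.Theory.

Local Open Scope ring_scope.

(* Formal power series in n commuting variables: a series is the family of   *)
(* its coefficients, indexed by the multi-exponents 'X_{1..n}.               *)
Record fps (n : nat) (R : Type) := Fps { fcoef : 'X_{1..n} -> R }.

Notation "F @^_ m" := (fcoef F m)
  (at level 3, m at level 2, left associativity, format "F @^_ m").

Section PowerSeriesRing.
Variables (n : nat) (R : comNzRingType).
Implicit Types (F G H : fps n R) (m : 'X_{1..n}).

HB.instance Definition _ := gen_eqMixin (fps n R).
HB.instance Definition _ := gen_choiceMixin (fps n R).

Lemma fpsP F G : (forall m, F@^_m = G@^_m) -> F = G.
Proof. by case: F G => [f] [g] /= fg; congr Fps; apply/funext. Qed.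

Definition fps_zero : fps n R := Fps (fun=> 0).
Definition fps_opp F : fps n R := Fps (fun m => - F@^_m).
Definition fps_add F G : fps n R := Fps (fun m => F@^_m + G@^_m).
Definition fps_one : fps n R := Fps (fun m => (m == 0%MM)%:R).
Definition fps_mul F G : fps n R := Fps (fun m =>
  \sum_(k : 'X_{1..n < (mdeg m).+1, (mdeg m).+1} | m == (k.1 + k.2)%MM)
     F@^_(k.1) * G@^_(k.2)).

Fact fps_addA : associative fps_add.
Proof. by move=> F G H; apply: fpsP => m /=; rewrite addrA. Qed.
Fact fps_addC : commutative fps_add.
Proof. by move=> F G; apply: fpsP => m /=; rewrite addrC. Qed.
Fact fps_add0 : left_id fps_zero fps_add.
Proof. by move=> F; apply: fpsP => m /=; rewrite add0r. Qed.
Fact fps_addN : left_inverse fps_zero fps_opp fps_add.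
Proof. by move=> F; apply: fpsP => m /=; rewrite addNr. Qed.

HB.instance Definition _ := GRing.isZmodule.Build (fps n R)
  fps_addA fps_addC fps_add0 fps_addN.

Definition fps_trunc d F : {mpoly R[n]} :=
  \sum_(k : 'X_{1..n < d}) F@^_k *: 'X_[k].

Lemma fps_truncE d F m : (mdeg m < d)%N -> (fps_trunc d F)@_m = F@^_m.
Proof. by move=> md; rewrite /fps_trunc (mcoeff_mpoly (fcoef F)). Qed.

(* The product of power series is computed by multiplying truncations.       *)
Lemma fps_mul_trunc (p q : {mpoly R[n]}) d F G m :
    (forall k, mdeg k < d -> p@_k = F@^_k)%N ->
    (forall k, mdeg k < d -> q@_k = G@^_k)%N -> (mdeg m < d)%N ->
  (p * q)@_m = (fps_mul F G)@^_m.
Proof.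
move=> pF qG md; rewrite mcoeffM /=; apply: eq_bigr => k _.
by rewrite pF ?qG ?(leq_trans (bmdeg _) md).
Qed.

Lemma fps_mulE d F G m : (mdeg m < d)%N ->
  (fps_mul F G)@^_m = (fps_trunc d F * fps_trunc d G)@_m.
Proof. by move=> md; rewrite (@fps_mul_trunc _ _ d F G) // => k; apply: fps_truncE. Qed.

Fact fps_mulA : associative fps_mul.
Proof.
move=> F G H; apply: fpsP => m; set d := (mdeg m).+1.
have tr K k : (mdeg k < d)%N -> (fps_trunc d K)@_k = K@^_k by exact: fps_truncE.
rewrite -(@fps_mul_trunc (fps_trunc d F) (fps_trunc d G * fps_trunc d H) d) //.
- rewrite mulrA (@fps_mul_trunc _ _ d (fps_mul F G) H) //.
    by move=> k kd; rewrite -fps_mulE.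
  exact: tr.
- exact: tr.
- by move=> k kd; rewrite -fps_mulE.
Qed.
Fact fps_mulC : commutative fps_mul.
Proof.
by move=> F G; apply: fpsP => m; rewrite !(@fps_mulE (mdeg m).+1) // mulrC.
Qed.
Fact fps_mul1 : left_id fps_one fps_mul.
Proof.
move=> F; apply: fpsP => m.
rewrite -(@fps_mul_trunc 1 (fps_trunc (mdeg m).+1 F) (mdeg m).+1) //.
- by rewrite mul1r fps_truncE.
- by move=> k _; rewrite mcoeff1.
- by move=> k; apply: fps_truncE.
Qed.
Fact fps_mulDl : left_distributive fps_mul fps_add.
Proof.
move=> F G H; apply: fpsP => m /=; rewrite -big_split /=.
by apply: eq_bigr => k _; rewrite mulrDl.
Qed.
Fact fps_one_neq0 : fps_one != fps_zero.
Proof.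
apply/eqP => /(congr1 (fun F => F@^_0%MM)) /eqP.
by rewrite /= eqxx oner_eq0.
Qed.

HB.instance Definition _ := GRing.Zmodule_isComNzRing.Build (fps n R)
  fps_mulA fps_mulC fps_mul1 fps_mulDl fps_one_neq0.

Definition fpsX (i : 'I_n) : fps n R := Fps (fun m => (m == U_(i)%MM)%:R).

Lemma fpsME F G m : (F * G)@^_m =
  \sum_(k : 'X_{1..n < (mdeg m).+1, (mdeg m).+1} | m == (k.1 + k.2)%MM)
     F@^_(k.1) * G@^_(k.2).
Proof. by []. Qed.
Lemma fps1E m : (1 : fps n R)@^_m = (m == 0%MM)%:R. Proof. by []. Qed.
Lemma fpsDE F G m : (F + G)@^_m = F@^_m + G@^_m. Proof. by []. Qed.
Lemma fpsNE F m : (- F)@^_m = - F@^_m. Proof. by []. Qed.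
Lemma fps_sumrE I (t : seq I) (P : pred I) (F : I -> fps n R) m :
  (\sum_(i <- t | P i) F i)@^_m = \sum_(i <- t | P i) (F i)@^_m.
Proof. by elim/big_rec2: _ => // i x y _ <-. Qed.

Lemma fps_pow_low H k m : H@^_0%MM = 0 -> (mdeg m < k)%N -> (H ^+ k)@^_m = 0.
Proof.
move=> H0; elim: k m => // k IHk m; rewrite ltnS => mk.
rewrite exprS fpsME big1 // => -[a b] /= /eqP mE.
have [a0|a0] := eqVneq (a : 'X_{1..n}) 0%MM; first by rewrite a0 H0 mul0r.
rewrite IHk ?mulr0 //; apply: leq_trans mk.
have := congr1 (@mdeg n) mE; rewrite mdegD => /esym/eq_leq; apply: leq_trans.
by rewrite -[ltnLHS]add0n ltn_add2r lt0n mdeg_eq0.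
Qed.

Lemma fps_mul_eq_low F F' G m :
    (forall k, mdeg k <= mdeg m -> F@^_k = F'@^_k)%N ->
  (F * G)@^_m = (F' * G)@^_m.
Proof.
move=> FF'; rewrite !fpsME; apply: eq_bigr => k _.
by rewrite FF' // -ltnS bmdeg.
Qed.

Lemma fps_Xn_low i k F m : (m i < k)%N -> (fpsX i ^+ k * F)@^_m = 0.
Proof.
elim: k m => // k IHk m; rewrite ltnS => mk.
rewrite exprS -mulrA fpsME big1 // => ab /eqP mE.
have [aE|neq] := eqVneq (ab.1 : 'X_{1..n}) U_(i)%MM; last first.
  by rewrite [fcoef (fpsX i) _]/= (negPf neq) mul0r.
rewrite IHk ?mulr0 //; apply: leq_trans mk.
by have := congr1 (fun k : 'X_{1..n} => k i) mE; rewrite mnmDE aE mnm1E eqxx => /esym/eq_leq; apply: leq_trans.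
Qed.

End PowerSeriesRing.

Arguments fps_mul : simpl never.

Section PowerSeriesInverse.
Variables (n : nat) (R : comUnitRingType).
Implicit Types (F G : fps n R) (m : 'X_{1..n}).

Definition fps_unit : pred (fps n R) := fun F => F@^_0%MM \is a GRing.unit.

(* If c is the (invertible) constant term of F, then F = c (1 - H) where H   *)
(* has no constant term, and F^-1 = c^-1 (1 + H + H^2 + ...); the terms from *)
(* H^(deg m + 1) on do not contribute to the coefficient of index m.         *)
Definition fps_inv F : fps n R :=
  if fps_unit F then
    let H := Fps (fun m => (m == 0%MM)%:R - (F@^_0%MM)^-1 * F@^_m) in
    Fps (fun m => (F@^_0%MM)^-1 * \sum_(i < (mdeg m).+1) (H ^+ i)@^_m)
  else F.

Fact fps_mulVr : {in fps_unit, left_inverse 1 fps_inv *%R}.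
Proof.
move=> F; rewrite -topredE /= => uF; apply: fpsP => m; rewrite /fps_inv uF.
set c := F@^_0%MM.
pose H : fps n R := Fps (fun m => (m == 0%MM)%:R - c^-1 * F@^_m).
pose C : fps n R := Fps (fun m => (m == 0%MM)%:R * c^-1).
have CE G k : (C * G)@^_k = c^-1 * G@^_k.
  set d := (mdeg k).+1; have -> : (C * G)@^_k = ((c^-1)%:MP * fps_trunc d G)@_k.
    apply/esym/(@fps_mul_trunc _ _ _ _ d) => // a; last exact: fps_truncE.
    by move=> _; rewrite mcoeffC mulrC.
  by rewrite mcoeffCM fps_truncE.
have HE : H = 1 - C * F.
  by apply: fpsP => k; rewrite fpsDE fpsNE CE fps1E.
have H0 : H@^_0%MM = 0 by rewrite /= eqxx mulVr ?subrr.
set S := \sum_(i < (mdeg m).+1) H ^+ i.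
rewrite (@fps_mul_eq_low _ _ _ (C * S)); last first.
  move=> k km; rewrite CE fps_sumrE; congr (_ * _).
  rewrite (big_ord_widen _ (fun i => (H ^+ i)@^_k) (_ : mdeg k < (mdeg m).+1)%N) //.
  rewrite big_mkcond /=; apply: eq_bigr => i _.
  by case: ifPn => //; rewrite -leqNgt => ki; rewrite fps_pow_low.
have -> : C * S * F = 1 - H ^+ (mdeg m).+1.
  rewrite -mulrA (mulrC S) mulrA.
  have -> : C * F = 1 - H by rewrite HE opprB addrC subrK.
  have := subrXX 1 H (mdeg m).+1; rewrite expr1n => ->; congr (_ * _).
  by apply: eq_bigr => i _; rewrite expr1n mul1r.
by rewrite fpsDE fpsNE (fps_pow_low H0) // subr0.
Qed.

Fact fps_unitPl F G : G * F = 1 -> fps_unit F.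
Proof.
move=> GF; apply/unitrPr; exists G@^_0%MM.
have := congr1 (fun K => K@^_0%MM) GF; rewrite mulrC.
by rewrite [LHS](@fps_mulE _ _ 1) ?mdeg0 // rmorphM /= !fps_truncE ?mdeg0 // eqxx.
Qed.

Fact fps_inv_out : {in [predC fps_unit], fps_inv =1 id}.
Proof. by move=> F; rewrite inE /= /fps_inv => /negPf; rewrite -topredE /= => ->. Qed.

HB.instance Definition _ := GRing.ComNzRing_hasMulInverse.Build (fps n R)
  fps_mulVr fps_unitPl fps_inv_out.

End PowerSeriesInverse.

Section InfiniteSums.
Variables (n : nat) (R : comNzRingType).
Local Open Scope classical_set_scope.

(* A family is summable when each coefficient is nonzero for finitely many   *)
(* members only; \sum_(i \in A) is the library's sum over the finite support *)
(* (equal to 0 if the support is infinite, hence the summability lemmas).    *)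
Definition fps_summable (I : choiceType) (A : set I) (F : I -> fps n R) :=
  forall m, finite_set [set i | A i /\ (F i)@^_m != 0].

Definition fps_sum (I : choiceType) (A : set I) (F : I -> fps n R) : fps n R :=
  Fps (fun m => \sum_(i \in A) (F i)@^_m).

Lemma summable_Xn (i : 'I_n) (A : set nat) (F : nat -> fps n R) :
  fps_summable A (fun k => fpsX R i ^+ k * F k).
Proof.
move=> m; apply: (sub_finite_set _ (finite_II (m i).+1)) => k [_].
by apply: contraNT; rewrite -leqNgt => ?; rewrite fps_Xn_low.
Qed.

Lemma summable_Xn2 (i j : 'I_n) (A : set (nat * nat)) (F : nat * nat -> fps n R) :
  fps_summable A (fun k => fpsX R i ^+ k.1 * fpsX R j ^+ k.2 * F k).
Proof.
move=> m.
apply: (sub_finite_set _ (finite_setX (finite_II (m i).+1) (finite_II (m j).+1))).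
move=> k [_ nz]; split; apply: contraNT nz; rewrite -leqNgt => ?.
  by rewrite -mulrA fps_Xn_low.
by rewrite -mulrA mulrCA fps_Xn_low.
Qed.

End InfiniteSums.

Definition var_u  : 'I_7 := @Ordinal 7 0 isT.
Definition var_t1 : 'I_7 := @Ordinal 7 1 isT.
Definition var_t2 : 'I_7 := @Ordinal 7 2 isT.
Definition var_q1 : 'I_7 := @Ordinal 7 3 isT.
Definition var_q2 : 'I_7 := @Ordinal 7 4 isT.
Definition var_a1 : 'I_7 := @Ordinal 7 5 isT.
Definition var_a2 : 'I_7 := @Ordinal 7 6 isT.

Definition u_  : fps 7 int := fpsX int var_u.
Definition t1_ : fps 7 int := fpsX int var_t1.
Definition t2_ : fps 7 int := fpsX int var_t2.
Definition q1_ : fps 7 int := fpsX int var_q1.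
Definition q2_ : fps 7 int := fpsX int var_q2.
Definition a1_ : fps 7 int := fpsX int var_a1.
Definition a2_ : fps 7 int := fpsX int var_a2.

(* {F}_{u^d q_1^p} *)
Definition restrict_uq1 (d p : nat) (F : fps 7 int) : fps 7 int :=
  Fps (fun m => if (d %| m var_u)%N && (p %| m var_q1)%N then F@^_m else 0).

(* The group G(r,n): coloured permutations. The colours are 'I_r.-1.+1,      *)
(* which is 'I_r as soon as 0 < r.                                           *)
Record colperm (r n : nat) := ColPerm {
  color : {ffun 'I_n -> 'I_r.-1.+1};
  under : 'S_n
}.

Section ColouredPermutations.
Variables r n : nat.
Implicit Types x y z : colperm r n.

Definition colperm_pair x := (color x, under x).
Definition pair_colperm (c : {ffun 'I_n -> 'I_r.-1.+1} * 'S_n) : colperm r n :=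
  ColPerm c.1 c.2.
Lemma colperm_pairK : cancel colperm_pair pair_colperm. Proof. by case. Qed.

HB.instance Definition _ := Finite.copy (colperm r n) (can_type colperm_pairK).

(* perm.v composes from left to right: (s * t)%g is t o s. *)
Definition colperm_mul x y : colperm r n :=
  ColPerm [ffun i => color y i + color x (under y i)] (under y * under x)%g.
Definition colperm_one : colperm r n := ColPerm [ffun=> 0] 1%g.
Definition colperm_inv x : colperm r n :=
  ColPerm [ffun i => - color x ((under x)^-1%g i)] (under x)^-1%g.

Fact colperm_mulA : associative colperm_mul.
Proof.
move=> x y z; rewrite /colperm_mul /= mulgA; congr ColPerm.
by apply/ffunP => i; rewrite !ffunE permM addrA.
Qed.
Fact colperm_mul1 : left_id colperm_one colperm_mul.
Proof.
case=> c s; rewrite /colperm_mul /= mulg1; congr ColPerm.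
by apply/ffunP => i; rewrite !ffunE addr0.
Qed.
Fact colperm_mulV : left_inverse colperm_one colperm_inv colperm_mul.
Proof.
case=> c s; rewrite /colperm_mul /colperm_one /= mulgV; congr ColPerm.
by apply/ffunP => i; rewrite !ffunE permK subrr.
Qed.

HB.instance Definition _ := Finite_isGroup.Build (colperm r n)
  colperm_mulA colperm_mul1 colperm_mulV.

End ColouredPermutations.

Section ProjectiveReflectionGroups.
Variables r p s n : nat.

Definition Grpn : {set colperm r n} :=
  [set g | p %| \sum_(i < n) (color g i : nat)]%N.

Definition Cs_gen : colperm r n := ColPerm [ffun=> inZp (r %/ s)] 1%g.
Definition Cs : {set colperm r n} := <[Cs_gen]>%g.

Definition Grpsn : {set coset_of Cs} := (Grpn / Cs)%g.

Lemma Grpn_group_set : (0 < r)%N -> (p %| r)%N -> group_set Grpn.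
Proof.
move=> r0 pr; have rE : (r.-1.+1 = r)%N by rewrite prednK.
have modp (k : nat) : (k %% r.-1.+1 = k %[mod p])%N by rewrite rE modn_dvdm.
apply/group_setP; split.
  by rewrite inE big1 // => i _; rewrite ffunE.
move=> x y; rewrite !inE /dvdn => /eqP xp /eqP yp; apply/eqP.
have -> : (\sum_i (color (x * y)%g i : nat) =
           \sum_i ((color y i : nat) + color x (under y i)) %[mod p])%N.
  rewrite -[LHS]modn_summ -[RHS]modn_summ; congr (_ %% _)%N.
  by apply: eq_bigr => i _; rewrite ffunE /= modp.
rewrite (reindex_inj (@perm_inj _ (under y))) /= in xp.
by rewrite big_split /= -modnDm yp xp mod0n.
Qed.

Lemma Cs_gen_central (g : colperm r n) : (g * Cs_gen = Cs_gen * g)%g.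
Proof.
congr ColPerm; rewrite /= ?mulg1 ?mul1g //.
by apply/ffunP => i; rewrite !ffunE perm1 addrC.
Qed.

End ProjectiveReflectionGroups.

Section Statistics.
Variables (r s n : nat).
Implicit Types g : colperm r n.

(* Positions are numbered from 0: lambda g 0 is lambda_1(g).                 *)
Definition HDes g : {set 'I_n} :=
  [set i : 'I_n | [exists j : 'I_n,
     [&& j == i.+1 :> nat, color g i == color g j & (under g j < under g i)%N]]].

Definition hstat g (i : nat) : nat := #|[set j in HDes g | (i <= j)%N]|.

(* k_i from the word c_i ... c_n; c - c' is the difference modulo r. *)
Fixpoint kword (w : seq 'I_r.-1.+1) : nat :=
  match w with
  | [::] => 0
  | [:: c] => (c %% (r %/ s))%N
  | c :: ((c' :: _) as w') => (kword w' + (c - c')%R)%N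
  end.

Definition kstat g (i : nat) : nat := kword (drop i [seq color g j | j <- enum 'I_n]).

Definition lambda g (i : nat) : nat := (r * hstat g i + kstat g i)%N.

Definition fmaj g : nat := (\sum_(i < n) lambda g i)%N.
Definition des g : nat := ((s * lambda g 0 + r - s) %/ r)%N.
Definition colstat g : nat := (\sum_(i < n) (color g i %% (r %/ s)))%N.

End Statistics.

(* An element of G(r,p,s,n) is a coset of C_s; its statistics are those of a *)
(* representative.                                                           *)
Definition Gdes (r s n : nat) (x : coset_of (Cs r s n)) : nat := des s (repr x).
Definition Gfmaj (r s n : nat) (x : coset_of (Cs r s n)) : nat := fmaj s (repr x).
Definition Gcol (r s n : nat) (x : coset_of (Cs r s n)) : nat := colstat s (repr x).

(* Main.v *)
Require Import Defs.
From HB Require Import structures.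
From mathcomp Require Import all_boot all_order all_algebra all_fingroup.
From mathcomp Require Import boolp classical_sets cardinality fsbigop.
From mathcomp Require Import mpoly zify ring.

(* Both sides count the same set by weight. A pair (k, f) with f a sequence  *)
(* of length n and f_1 <= k r/s is compatible with g = (c; sigma) when f is  *)
(* weakly decreasing, sigma increases along the ties of f, and c_i is f_i    *)
(* mod r up to a common multiple of r/s. Writing f as lambda(g) plus         *)
(* multiples of r on proper prefixes and a multiple of r/s on all of f shows *)
(* that, with weight t^k q^(sum f) a^(sum R_(r/s)(f)), these pairs have      *)
(* series t^des q^fmaj a^col over the denominator. If f is compatible with g *)
(* and f' with g^-1, then the pairs (f_i, f'_(sigma i)) form a               *)
(* lexicographically sorted list, with f_i + f'_(sigma i) = l r/s mod r for  *)
(* a common l < s; conversely such a list determines sigma as its stable     *)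
(* sorting permutation for the second entry, and then the class of g modulo  *)
(* C_s. These lists are the multisets counted by the product over (i, j).    *)

Set Implicit Arguments.
Unset Strict Implicit.
Unset Printing Implicit Defensive.

Import GRing.Theory.

Local Open Scope ring_scope.

(** * Series counting the elements of a set by weight *)

(** Every series here is the generating function of a weighted set ([is_gf]), and two series
    counting the same set agree ([is_gf_unique]). Products, sums and geometric series become
    operations on sets, so the identity reduces to weight-preserving bijections ([is_gf_bij]).

    The left-hand side counts words: bounds (k1, k2), a residue l < s and a sorted list of pairs
    ([is_gf_lhs], built on [is_gf_msets]). For a fixed g, the compatible pairs (k, f) are freely
    parametrised by natural numbers ([compatible_fill], [fill_compatible]), which gives t^des q^fmaj
    a^col over the one-sided denominator ([is_gf_side]). Multiplying the series of g and of g^-1 and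
    summing over the group, the fraction at u^n counts triples (g, (k1, f), (k2, f')). By
    [pairing_sorted], [pairing_inj] and [pairing_surj] these are the words of length n > 0. Passing
    to the quotient by C_s makes g unique ([compatible_coset_inj]); when d divides n, lying in
    G(r,p,s,n) means that p divides the sum of f ([mem_Grpsn_compatible]). Length 0 is settled by
    [is_gf_size0]. *)

Definition fpsM (n : nat) (R : comNzRingType) (m : 'X_{1..n}) : fps n R :=
  Fps (fun k => (k == m)%:R).

Section GeneratingFunctions.
Variable n : nat.
Implicit Types (m : 'X_{1..n}) (F G : fps n int).

(* The list s is the fibre of w over m, which is thus required to be finite. *)
Definition is_gf (T : eqType) (A : T -> Prop) (w : T -> 'X_{1..n}) F :=
  forall m, exists2 s : seq T,
    uniq s /\ (forall a, a \in s <-> A a /\ w a = m) & F@^_m = (size s)%:R.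

Lemma is_gf_unique (T : eqType) (A : T -> Prop) (w : T -> 'X_{1..n}) F G :
  is_gf A w F -> is_gf A w G -> F = G.
Proof.
move=> FA GA; apply: fpsP => m.
have [s [us sA] ->] := FA m; have [t [ut tA] ->] := GA m.
congr (_%:R); apply/perm_size/uniq_perm => // a.
by apply/idP/idP => [/sA /tA|/tA /sA].
Qed.

Lemma is_gf_bij (T U : eqType) (phi : T -> U) (A : T -> Prop) (B : U -> Prop)
    (w : T -> 'X_{1..n}) (v : U -> 'X_{1..n}) F :
  (forall a, A a -> B (phi a)) ->
  (forall a a', A a -> A a' -> phi a = phi a' -> a = a') ->
  (forall b, B b -> exists2 a, A a & phi a = b) ->
  (forall a, A a -> v (phi a) = w a) ->
  is_gf A w F -> is_gf B v F.
Proof.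
move=> AB inj surj wv FA m; have [s [us sA] ->] := FA m.
exists (map phi s); last by rewrite size_map.
split=> [|b].
  rewrite map_inj_in_uniq // => a a' /sA[Aa _] /sA[Aa' _]; exact: inj.
split=> [/mapP[a /sA[Aa wa] ->]|[Bb vb]]; first by rewrite wv //; split; auto.
have [a Aa ab] := surj b Bb; rewrite -ab map_f //; apply/sA; split=> //.
by rewrite -wv // ab.
Qed.

Lemma is_gf_ext (T : eqType) (A B : T -> Prop) (w v : T -> 'X_{1..n}) F :
  (forall a, A a <-> B a) -> (forall a, A a -> v a = w a) ->
  is_gf A w F -> is_gf B v F.
Proof.
move=> AB wv; apply: (@is_gf_bij _ _ id) => // [a /AB //|b /AB Ab].
by exists b.
Qed.

Lemma is_gf1 (T : eqType) (x : T) (w : T -> 'X_{1..n}) :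
  is_gf (fun a => a = x) w (fpsM int (w x)).
Proof.
move=> m; have [->|mx] := eqVneq m (w x).
  exists [:: x]; last by rewrite /= eqxx.
  split=> // a; rewrite inE; split=> [/eqP->|[-> _]] //.
exists [::]; last by rewrite /= (negPf mx).
by split=> // a; split=> // -[-> xm]; rewrite xm eqxx in mx.
Qed.

Lemma is_gf0 (T : eqType) (w : T -> 'X_{1..n}) : is_gf (fun=> False) w 0.
Proof. by move=> m; exists [::] => //; split=> // a; split=> // -[]. Qed.

Lemma is_gf_filter (T : eqType) (A : T -> Prop) (w : T -> 'X_{1..n})
    (P : pred 'X_{1..n}) F :
  is_gf A w F ->
  is_gf (fun a => A a /\ P (w a)) w (Fps (fun m => if P m then F@^_m else 0)).
Proof.
move=> FA m /=; case: ifPn => Pm; last first.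
  by exists [::] => //; split=> // a; split=> // -[[_ +] wa]; rewrite wa (negPf Pm).
have [s [us sA] ->] := FA m; exists s => //; split=> // a.
by split=> [/sA[Aa wa]|[[Aa _] wa]]; [rewrite wa | apply/sA].
Qed.

(** A pair of total weight m determines its splitting of m, so its fibre is the disjoint union, over
    the splittings of m, of products of fibres: the Cauchy product. The fibre lists are picked by
    choice, since [is_gf] only asserts that they exist. *)
Lemma is_gf_prod (T U : eqType) (A : T -> Prop) (B : U -> Prop)
    (w : T -> 'X_{1..n}) (v : U -> 'X_{1..n}) F G :
  is_gf A w F -> is_gf B v G ->
  is_gf (fun x : T * U => A x.1 /\ B x.2) (fun x => w x.1 + v x.2)%MM (F * G).
Proof.
move=> FA GB m.
have fP m' : {s : seq T | uniq s /\ (forall a, a \in s <-> A a /\ w a = m') &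
    F@^_m' = (size s)%:R} by apply/cid2/FA.
have gP m' : {s : seq U | uniq s /\ (forall a, a \in s <-> B a /\ v a = m') &
    G@^_m' = (size s)%:R} by apply/cid2/GB.
pose f m' := s2val (fP m'); pose g m' := s2val (gP m').
have [fu fE] : (forall m', uniq (f m')) /\
    (forall m' a, a \in f m' <-> A a /\ w a = m').
  by split=> m'; have [] := s2valP (fP m').
have [gu gE] : (forall m', uniq (g m')) /\
    (forall m' a, a \in g m' <-> B a /\ v a = m').
  by split=> m'; have [] := s2valP (gP m').
have fF m' : F@^_m' = (size (f m'))%:R by exact: (s2valP' (fP m')).
have gG m' : G@^_m' = (size (g m'))%:R by exact: (s2valP' (gP m')).
pose d := (mdeg m).+1.
pose P (k : 'X_{1..n < d, d}) := m == (k.1 + k.2)%MM.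
pose ks := [seq k <- index_enum {: 'X_{1..n < d, d}} | P k].
pose L (k : 'X_{1..n < d, d}) := allpairs pair (f k.1) (g k.2).
exists (flatten (map L ks)).
  split=> [|[a b]].
    have: uniq ks by rewrite filter_uniq ?index_enum_uniq.
    elim: (ks) => //= k ks' IH /andP[kks uks].
    rewrite cat_uniq IH // andbT allpairs_uniq //=; last by move=> [? ?] [].
    apply/hasPn => -[a b] /flattenP[s /mapP[k' k'ks ->]].
    move=> /allpairsP[[a' b'] [/= /fE[_ wa] /gE[_ vb] [aE bE]]].
    apply/negP => /allpairsP[[a2 b2] [/= /fE[_ wa2] /gE[_ vb2] [aE2 bE2]]].
    move: kks; rewrite (_ : k = k') ?k'ks //.
    case: k k' wa2 vb2 wa vb {k'ks} => [k1 k2] [k1' k2'] /= wa2 vb2 wa vb.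
    by congr pair; apply: val_inj => /=; rewrite -?wa2 -?vb2 -?wa -?vb -?aE -?bE ?aE2 ?bE2.
  split=> [/flattenP[s /mapP[k]]|[[Aa Bb] /= wv]].
    rewrite mem_filter => /andP[/eqP mk _] ->
      /allpairsP[[a' b'] /= [/fE[Aa wa] /gE[Bb vb] [-> ->]]].
    by rewrite /= wa vb.
  have wd : (mdeg (w a) < d)%N by rewrite /d -wv mdegD ltnS leq_addr.
  have vd : (mdeg (v b) < d)%N by rewrite /d -wv mdegD ltnS leq_addl.
  apply/flattenP; exists (L (BMultinom wd, BMultinom vd)).
    apply: map_f.
    by rewrite mem_filter /P /= wv eqxx mem_index_enum.
  by apply/allpairsP; exists (a, b); split=> //; [apply/fE | apply/gE].
rewrite fpsME size_flatten /shape -map_comp sumnE big_map big_filter natr_sum.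
by apply: eq_bigr => k _; rewrite /= size_allpairs natrM fF gG.
Qed.

Lemma is_gf_union (T : eqType) (A B : T -> Prop) (w : T -> 'X_{1..n}) F G :
  (forall a, A a -> ~ B a) -> is_gf A w F -> is_gf B w G ->
  is_gf (fun a => A a \/ B a) w (F + G).
Proof.
move=> AB FA GB m; have [s [us sA] sF] := FA m; have [t [ut tB] tG] := GB m.
exists (s ++ t); last by rewrite size_cat natrD fpsDE sF tG.
split=> [|a].
  rewrite cat_uniq us ut andbT; apply/hasPn => a /tB[Ba _].
  by apply/negP => /sA[/AB].
rewrite mem_cat; split=> [/orP[/sA|/tB]|[[Aa|Ba] wa]].
- by case; auto.
- by case; auto.
- by apply/orP; left; apply/sA.
- by apply/orP; right; apply/tB.
Qed.

(** The index is kept in the pair, so the sets [A i] may overlap. *)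
Lemma is_gf_sum (I T : eqType) (r : seq I) (A : I -> T -> Prop)
    (w : I -> T -> 'X_{1..n}) (F : I -> fps n int) :
  uniq r -> (forall i, i \in r -> is_gf (A i) (w i) (F i)) ->
  is_gf (fun x : I * T => x.1 \in r /\ A x.1 x.2) (fun x => w x.1 x.2)
    (\sum_(i <- r) F i).
Proof.
elim: r => [_ _|i r IH /= /andP[ir ur] FA].
  rewrite big_nil; apply: is_gf_ext (is_gf0 (fun x => w x.1 x.2)) => // x; rewrite in_nil.
  by split=> // -[].
rewrite big_cons.
apply: (@is_gf_ext _ (fun x : I * T => (x.1 = i /\ A x.1 x.2) \/
                                      (x.1 \in r /\ A x.1 x.2))) => //.
  move=> [j a] /=; rewrite inE; split=> [[[->]|[-> Aa]]|[/orP[/eqP|]]]; rewrite ?eqxx ?orbT //; auto.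
apply: is_gf_union; first by move=> [j a] /= [-> _] [/(negP ir)].
  apply: (is_gf_bij (phi := fun a => (i, a))) (FA i (mem_head _ _)) => //=.
  - by move=> a a' _ _ [].
  - by move=> [j a] /= [-> Aa]; exists a.
by apply: IH => // j jr; apply: FA; rewrite inE jr orbT.
Qed.

(* The sum over k is in effect finite in each degree: a term of degree m can *)
(* only come from k = kappa m.                                               *)
Lemma is_gf_fps_sum (I : choiceType) (T : eqType) (D : set I) (A : I -> T -> Prop)
    (w : I -> T -> 'X_{1..n}) (F : I -> fps n int) (kappa : 'X_{1..n} -> I) :
  (forall k, D k -> is_gf (A k) (w k) (F k)) ->
  (forall k a, A k a -> kappa (w k a) = k) ->
  is_gf (fun x : I * T => D x.1 /\ A x.1 x.2) (fun x => w x.1 x.2) (fps_sum D F).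
Proof.
move=> FA kw m /=.
have F0 k : D k -> k != kappa m -> (F k)@^_m = 0.
  move=> Dk kn; have [s [_ sA] ->] := FA k Dk m; case: s sA => // a s sA.
  have [Aa wa] : A k a /\ w k a = m by apply/sA/mem_head.
  by move: kn; rewrite -wa kw ?eqxx.
have [Dk|nDk] := pselect (D (kappa m)); last first.
  exists [::].
    by split=> // -[k a]; split=> // -[[/= Dk Aa] wa]; case: nDk; rewrite -wa kw.
  rewrite /= fsbig1 // => k Dk; apply: F0 => //.
  by apply/eqP => kE; apply: nDk; rewrite -kE.
have [s [us sA] sF] := FA _ Dk m; exists [seq (kappa m, a) | a <- s].
  split; first by rewrite map_inj_uniq // => a b [].
  move=> [k a]; split=> [/mapP[b /sA[Ab wb] [-> ->]] //|[[/= D' Aa] wa]].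
  have kE : k = kappa m by rewrite -wa kw.
  by rewrite kE map_f //; apply/sA; rewrite -kE.
rewrite /= size_map -sF.
rewrite -(fsbig_widen [set kappa m] D) ?fsbig_set1 //.
  by move=> k ->.
by move=> k [Dk' /eqP kn]; apply: F0.
Qed.

End GeneratingFunctions.

(** * Monomials, geometric series and their products *)

Section Monomials.
Variable n : nat.
Implicit Types (m M : 'X_{1..n}).

Lemma fpsM0 : fpsM int 0%MM = 1 :> fps n int.
Proof. by apply: fpsP. Qed.

Lemma fpsMD m m' : fpsM int (m + m')%MM = fpsM int m * fpsM int m'.
Proof.
apply: (is_gf_unique (is_gf1 tt (fun=> (m + m')%MM))).
apply: (is_gf_bij (phi := (fun=> tt)) _ _ _ _
  (is_gf_prod (is_gf1 tt (fun=> m)) (is_gf1 tt (fun=> m')))).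
- by [].
- by move=> [[] []] [[] []].
- by move=> [] _; exists (tt, tt).
- by [].
Qed.

Lemma fpsXE (i : 'I_n) k : fpsX int i ^+ k = fpsM int (U_(i) *+ k)%MM.
Proof.
elim: k => [|k IH]; first by rewrite expr0 mulm0n fpsM0.
by rewrite exprS IH mulmS fpsMD.
Qed.

Lemma fpsM_unit M : M != 0%MM -> 1 - fpsM int M \is a GRing.unit.
Proof.
move=> M0; rewrite unfold_in /= /fps_unit fpsDE fpsNE fps1E /= eqxx eq_sym.
by rewrite (negPf M0) subr0 unitr1.
Qed.

Lemma is_gf_shift (T : eqType) (A : T -> Prop) (w : T -> 'X_{1..n}) F m :
  is_gf A w F -> is_gf A (fun a => (m + w a)%MM) (fpsM int m * F).
Proof.
move=> FA; apply: (is_gf_bij (phi := snd) _ _ _ _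
  (is_gf_prod (is_gf1 tt (fun=> m)) FA)).
- by move=> [? ?] [_].
- by move=> [[] ?] [[] ?] _ _ /= ->.
- by move=> a Aa; exists (tt, a).
- by [].
Qed.

(** Multiples of a nonzero M are distinct, so the counting series F is the indicator of these
    multiples. Separating 0 from the successors gives F = 1 + x^M F, hence F is the inverse of 1 -
    x^M. *)
Lemma is_gf_geom M : M != 0%MM ->
  is_gf (fun _ : nat => True) (fun k => M *+ k)%MM (1 - fpsM int M)^-1.
Proof.
move=> M0; have [i Mi] : exists i, (0 < M i)%N.
  apply/existsP; apply: contraNT M0 => /existsPn Mi; apply/eqP/mnmP => i.
  by have := Mi i; rewrite -eqn0Ngt mnm0E => /eqP.
have inj k l : (M *+ k = M *+ l)%MM -> k = l.
  move=> /(congr1 (fun m : 'X_{1..n} => m i)); rewrite !mulmnE.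
  by move/eqP; rewrite eqn_pmul2l // => /eqP.
pose F : fps n int := Fps (fun m => `[< exists k, m = M *+ k >]%MM%:R).
have FE : is_gf (fun _ : nat => True) (fun k => M *+ k)%MM F.
  move=> m /=; case: asboolP => [[k ->]|nk].
    exists [:: k] => //; split=> // l; rewrite inE.
    by split=> [/eqP -> //|[_ /inj ->]].
  exists [::] => //; split=> // l; split=> // -[_ ml].
  by case: nk; exists l.
suff F1 : F = 1 + fpsM int M * F.
  have F2 : (1 - fpsM int M) * F = 1 by rewrite mulrBl mul1r {1}F1 addrK.
  by rewrite (mulr1_eq F2).
apply: (is_gf_unique FE); rewrite -fpsM0 -[0%MM](mulm0n M).
apply: (@is_gf_ext _ _ (fun k => k = 0%N \/ (0 < k)%N)).
- by case=> [|k]; split=> // _; [left | right].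
- by [].
apply: is_gf_union => [k -> //||]; first exact: (is_gf1 0%N (fun k => M *+ k)%MM).
apply: (is_gf_bij (phi := S) _ _ _ _
  (is_gf_shift M FE)).
- by [].
- by move=> k l _ _ [].
- by case=> // k _; exists k.
- by move=> k _; rewrite mulmS.
Qed.

(** Sorted lists are normal forms of multisets, and a multiset over [x :: J] is a multiplicity of x
    together with a multiset over J. *)
Lemma is_gf_msets (T : eqType) (le : rel T) (M : T -> 'X_{1..n}) (J : seq T) :
  total le -> transitive le -> antisymmetric le -> uniq J ->
  (forall x, x \in J -> M x != 0%MM) ->
  is_gf (fun s : seq T => sorted le s /\ {subset s <= J})
        (fun s => \big[mnm_add/0%MM]_(x <- s) M x)
        (\prod_(x <- J) (1 - fpsM int (M x))^-1).
Proof.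
move=> le_total le_trans le_asym.
elim: J => [_ _|x J IH /= /andP[xJ uJ] M0].
  rewrite big_nil -fpsM0.
  apply: is_gf_ext (is_gf1 [::] (fun=> 0%MM)) => [s|s ->]; last by rewrite big_nil.
  split=> [->|[_ sJ]]; first by [].
  by case: s sJ => // y s /(_ y (mem_head _ _)).
rewrite big_cons; have M0' y : y \in J -> M y != 0%MM.
  by move=> yJ; apply: M0; rewrite inE yJ orbT.
apply: (is_gf_bij (phi := (fun y : nat * seq T => sort le (nseq y.1 x ++ y.2))) _ _ _ _
  (is_gf_prod (is_gf_geom (M0 _ (mem_head _ _))) (IH uJ M0'))).
- move=> [k s] /= [_ [_ sJ]]; split; first exact: sort_sorted.
  move=> y; rewrite mem_sort mem_cat mem_nseq inE => /orP[/andP[_ ->] //|/sJ ->].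
  by rewrite orbT.
- move=> [k s] [k' s'] /= [_ [ss sJ]] [_ [ss' sJ']] /= /(perm_sortP le_total le_trans le_asym) pE.
  have xs t : {subset t <= J} -> count_mem x t = 0%N.
    by move=> tJ; apply/count_memPn/negP => /tJ; rewrite (negPf xJ).
  have kk : k = k'.
    have /seq.permP /(_ (pred1 x)) := pE.
    by rewrite !count_cat !count_nseq !xs //= eqxx !addn0 !mul1n.
  rewrite kk perm_cat2l in pE *; congr pair.
  exact: (sorted_eq le_trans le_asym).
- move=> s [ss sJ]; exists (count_mem x s, filter (predC1 x) s) => /=.
    split=> //; split; first exact: sorted_filter.
    by move=> y; rewrite mem_filter => /andP[/= /negPf yx /sJ]; rewrite inE yx.
  apply: (sorted_eq le_trans le_asym) => //; first exact: sort_sorted.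
  rewrite perm_sort perm_sym; apply: perm_trans (_ : perm_eq s _) _ => //.
  rewrite -(perm_filterC (pred1 x) s) perm_sym perm_cat //.
  suff -> : filter (pred1 x) s = nseq (count_mem x s) x by [].
  by elim: s {ss sJ} => //= y s ->; case: eqP => [->|].
- move=> [k s] _ /=; rewrite (perm_big _ (permEl (perm_sort _ _))) big_cat /=.
  by congr (_ + _)%MM; elim: k => [|k IHk]; rewrite ?big_nil //= big_cons IHk -mulmS.
Qed.

Lemma is_gf_exponents k (M : nat -> 'X_{1..n}) :
  (forall i, (i < k)%N -> M i != 0%MM) ->
  is_gf (fun e : seq nat => size e = k)
        (fun e => \big[mnm_add/0%MM]_(i < k) (M i *+ nth 0%N e i)%MM)
        (\prod_(i < k) (1 - fpsM int (M i))^-1).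
Proof.
elim: k M => [|k IH] M M0.
  rewrite big_ord0 -fpsM0; apply: is_gf_ext (is_gf1 [::] (fun=> 0%MM)) => [e|e ->].
    by split=> [-> //|/size0nil].
  by rewrite big_ord0.
rewrite big_ord_recl.
apply: (is_gf_bij (phi := (fun x : nat * seq nat => x.1 :: x.2)) _ _ _ _
  (is_gf_prod (is_gf_geom (M0 0%N isT)) (IH (M \o S) _))).
- by move=> [a e] /= [_ ->].
- by move=> [a e] [a' e'] /= _ _ [-> ->].
- by case=> // a e [se]; exists (a, e).
- by move=> [a e] _ /=; rewrite big_ord_recl.
- by move=> i ik; apply: M0.
Qed.

End Monomials.

(** * Sequences compatible with a coloured permutation *)

Section OneSide.
Variables r s n : nat.
Hypotheses (r_gt0 : (0 < r)%N) (s_gt0 : (0 < s)%N) (sr : (s %| r)%N).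
Let rs := (r %/ s)%N.
Implicit Types (g : colperm r n) (f : seq nat) (i j : 'I_n).

Let rsE : (rs * s = r)%N. Proof. by rewrite divnK. Qed.
Let rs_gt0 : (0 < rs)%N. Proof. by rewrite divn_gt0 // dvdn_leq. Qed.

(** The free common shift [b] is what makes the notion invariant under C_s ([compatible_Cs]). *)
Definition compatible g f := [/\ size f = n,
  (forall i j, (i < j)%N -> (nth 0%N f j < nth 0%N f i)%N ||
     (nth 0%N f i == nth 0%N f j)%N && (under g i < under g j)%N)
  & exists b, forall i, (nth 0%N f i = color g i + b * rs %[mod r])%N].

Let eq_modr a b : (a = b %[mod r.-1.+1] -> a = b %[mod r])%N.
Proof. by rewrite prednK. Qed.

Lemma color_lt (c : 'I_r.-1.+1) : (c < r)%N.
Proof. by case: c => c /=; rewrite prednK. Qed.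

Lemma color_subK (c c' : 'I_r.-1.+1) : ((c - c')%R + c' = c %[mod r])%N.
Proof. by apply: eq_modr; rewrite -{2}(subrK c' c) /= modn_mod. Qed.

Lemma kword_cons (c c' : 'I_r.-1.+1) w :
  kword s (c :: c' :: w) = (kword s (c' :: w) + (c - c')%R)%N.
Proof. by []. Qed.

Let size_colors g : size [seq color g j | j <- enum 'I_n] = n.
Proof. by rewrite size_map size_enum_ord. Qed.

Let drop_colors g i : drop i [seq color g j | j <- enum 'I_n] =
  color g i :: drop i.+1 [seq color g j | j <- enum 'I_n].
Proof.
have iE : (i < size (enum 'I_n))%N by rewrite size_enum_ord.
rewrite (drop_nth (color g i)) ?size_colors //; congr (_ :: _).
by rewrite (nth_map i) // nth_ord_enum.
Qed.

Lemma hstatS g i : hstat g i = ((i \in HDes g) + hstat g i.+1)%N.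
Proof.
rewrite /hstat (cardsD1 i) !inE leqnn andbT; congr (_ + #|pred_of_set _|)%N.
by apply/setP => j; rewrite !inE -(inj_eq val_inj) /=; case: (HDes g) => * ; lia.
Qed.

(** With [lambda_out] and [lambda_last], this recursion is all that is used later of h_i and k_i. *)
Lemma lambda_step g i j : j = i.+1 :> nat ->
  lambda s g i = (lambda s g j + r * (i \in HDes g) + (color g i - color g j)%R)%N.
Proof.
move=> ji; rewrite /lambda hstatS -ji /kstat drop_colors -ji drop_colors kword_cons.
lia.
Qed.

Lemma lambda_out g k : (n <= k)%N -> lambda s g k = 0%N.
Proof.
move=> nk; rewrite /lambda /kstat drop_oversize ?size_colors //= addn0.
rewrite /hstat (_ : [set _ in _ | _] = finset.set0) ?cards0 ?muln0 //.
by apply/setP => j; rewrite !inE andbC leqNgt (leq_trans (ltn_ord j) nk).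
Qed.

Lemma lambda_last g i : i.+1 = n -> lambda s g i = (color g i %% rs)%N.
Proof.
move=> iN; rewrite /lambda hstatS /kstat drop_colors [drop _ _]drop_oversize; last first.
  by rewrite size_colors iN.
have := lambda_out g (eq_leq (esym iN)); rewrite /lambda => /eqP.
rewrite addn_eq0 muln_eq0 => /andP[/orP[|/eqP -> _]]; first by lia.
rewrite inE; case: existsP => [[j /and3P[/eqP jE _ _]]|_]; last by rewrite muln0.
by have := ltn_ord j; rewrite jE iN ltnn.
Qed.

(** Adding r to a proper prefix keeps the residues modulo r; adding r/s to the whole sequence only
    changes the common shift. [kstep] is the same amount in units of r/s, hence the increase it
    forces on the bound k. *)
Definition step k := if (k.+1 < n)%N then r else rs.
Definition kstep k := if (k.+1 < n)%N then s else 1%N.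
Definition gap g k := (lambda s g k - lambda s g k.+1)%N.
(* e_k counts how often step k is added to the entries 0, ..., k of lambda. *)
Definition fill g (e : seq nat) : seq nat :=
  mkseq (fun k => \sum_(k <= l < n) (gap g l + step l * nth 0%N e l))%N n.

Lemma stepE k : (rs * kstep k)%N = step k.
Proof. by rewrite /kstep /step; case: ifP; rewrite ?muln1. Qed.

Let step_gt0 k : (0 < step k)%N.
Proof. by rewrite /step; case: ifP. Qed.

Lemma lambda_gap g k : lambda s g k = (lambda s g k.+1 + gap g k)%N.
Proof.
rewrite /gap addnC subnK //; case: (ltnP k n) => kn; last first.
  by rewrite !lambda_out // leqW.
case: (ltnP k.+1 n) => k1n; last by rewrite (lambda_out g k1n).
by rewrite (@lambda_step g (Ordinal kn) (Ordinal k1n)) //= -addnA leq_addr.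
Qed.

Lemma lambda_sum g k : lambda s g k = (\sum_(k <= l < n) gap g l)%N.
Proof.
case: (leqP n k) => [nk|/ltnW kn]; first by rewrite big_geq // lambda_out.
rewrite -(subKn kn); elim: (n - k)%N (leq_subr k n) => [_|d IH dn].
  by rewrite subn0 big_geq // lambda_out.
rewrite big_ltn ?ltn_subrL ?(leq_trans _ dn) // lambda_gap subnSK // IH 1?ltnW //.
by rewrite addnC.
Qed.

Lemma nth_fill g e k :
  nth 0%N (fill g e) k = (\sum_(k <= l < n) (gap g l + step l * nth 0%N e l))%N.
Proof.
case: (ltnP k n) => kn; first by rewrite nth_mkseq.
by rewrite nth_default ?size_mkseq // big_geq.
Qed.

Lemma nth_fillS g e k : (k < n)%N ->
  nth 0%N (fill g e) k = (nth 0%N (fill g e) k.+1 + gap g k + step k * nth 0%N e k)%N.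
Proof. by move=> kn; rewrite !nth_fill big_ltn // addnC addnA. Qed.

Lemma fill_inj g e e' : size e = n -> size e' = n -> fill g e = fill g e' -> e = e'.
Proof.
move=> se se' ee'; apply: (@eq_from_nth _ 0%N); rewrite ?se ?se' // => k kn.
have := nth_fillS g e kn; rewrite ee' (nth_fillS g e' kn) => /addnI /eqP.
by rewrite eqn_pmul2l // => /eqP ->.
Qed.

(** The congruences fix the difference of neighbours modulo r. At a homogeneous descent a tie is
    forbidden, so the difference is at least r, which is what [gap] contains there. *)
Lemma compatible_step g f k : compatible g f -> (k < n)%N ->
  exists e, nth 0%N f k = (nth 0%N f k.+1 + gap g k + step k * e)%N.
Proof.
case=> sf ford [b fb] kn; pose i := Ordinal kn.
have fi : (nth 0%N f k = color g i + b * rs %[mod r])%N by exact: (fb i).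
rewrite /gap /step; case: ltnP => k1n; last first.
  have kN : k.+1 = n by apply/eqP; rewrite eqn_leq kn k1n.
  rewrite (lambda_out g k1n) subn0 (@lambda_last g i) // [nth 0%N f k.+1]nth_default ?sf //.
  (* At the last position the unknown shift leaves a congruence modulo r/s only, and the gap is the
     remainder. *)
  exists (nth 0%N f k %/ rs)%N; rewrite add0n addnC mulnC {1}(divn_eq (nth 0%N f k) rs).
  congr addn; have /(congr1 (modn^~ rs)) := fi.
  by rewrite !modn_dvdm ?modnMDl 1?addnC ?modnMDl // -rsE dvdn_mulr.
pose j := Ordinal k1n; have ji : j = i.+1 :> nat by [].
have fj : (nth 0%N f k.+1 = color g j + b * rs %[mod r])%N by exact: (fb j).
rewrite (lambda_step g ji) -addnA addKn.
have fij := ford i j (leqnn _); rewrite /= in fij; move: fij.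
set x := nth 0%N f k; set y := nth 0%N f k.+1.
move=> xy; have yx : (y <= x)%N by case/orP: xy => [/ltnW|/andP[/eqP ->]].
set v := (color g i - color g j)%R.
have xyv : ((x - y) %% r = v)%N.
  rewrite -[RHS](modn_small (color_lt v)); apply/eqP.
  rewrite -(eqn_modDr y) subnK // -(eqn_modDr (color g j)).
  rewrite [in eqbRHS]addnAC -[in eqbRHS]modnDml color_subK modnDml.
  rewrite -/x in fi; rewrite -/y in fj.
  rewrite -[in eqbLHS]modnDml fi modnDml -[in eqbRHS]modnDmr fj modnDmr.
  by apply/eqP; congr (_ %% _)%N; lia.
case: (boolP (i \in HDes g)) => iD; last first.
  exists ((x - y) %/ r)%N; rewrite muln0 add0n -xyv.
  by have := divn_eq (x - y) r; lia.
have xly : (y < x)%N /\ v = 0%R.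
  move: iD; rewrite inE => /existsP[j' /and3P[/eqP j'i /eqP cc]].
  have -> : j' = j by apply: val_inj.
  move=> uu; split; last by rewrite /v cc (_ : j' = j) ?subrr //; apply: val_inj.
  by move: xy; rewrite (ltnNge (under g i)) (ltnW uu) andbF orbF.
(* The residue is 0 and x > y, so the quotient is positive; one of its copies of r is already in the
   gap. *)
exists ((x - y) %/ r).-1; rewrite muln1.
have := divn_eq (x - y) r; rewrite xyv xly.2 /=.
case: ((x - y) %/ r)%N => [|q]; rewrite ?mulSn ?(mulnC r) /=; first by clear -xly; lia.
by move: xly.1 (q * r)%N; clear; lia.
Qed.

Lemma compatible_fill g f :
  compatible g f -> exists2 e, size e = n & f = fill g e.
Proof.
move=> cf; have sf : size f = n by case: cf.
have /choice[e eE] : forall k, exists e, (k < n)%N ->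
    nth 0%N f k = (nth 0%N f k.+1 + gap g k + step k * e)%N.
  move=> k; case: (ltnP k n) => kn; last by exists 0%N.
  by have [e] := compatible_step cf kn; exists e.
exists (mkseq e n); first by rewrite size_mkseq.
apply: (@eq_from_nth _ 0%N) => [|k _]; first by rewrite size_mkseq.
case: (leqP n k) => [nk|/ltnW kn]; first by rewrite !nth_default ?size_mkseq ?sf.
rewrite -(subKn kn); elim: (n - k)%N (leq_subr k n) => [_|d IH dn].
  by rewrite subn0 !nth_default ?size_mkseq ?sf.
have dn' : (n - d.+1 < n)%N by rewrite ltn_subrL (leq_trans _ dn).
by rewrite eE // nth_fillS // subnSK // IH 1?ltnW // nth_mkseq.
Qed.

(** Order is checked on adjacent positions and propagated by induction on the distance; the
    congruence is propagated from the last position backwards. *)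
Lemma fill_compatible g e : compatible g (fill g e).
Proof.
set f := fill g e.
have ford k (kn : (k < n)%N) (k1n : (k.+1 < n)%N) :
  (nth 0%N f k.+1 < nth 0%N f k)%N || (nth 0%N f k == nth 0%N f k.+1) &&
     (under g (Ordinal kn) < under g (Ordinal k1n))%N.
  rewrite /f (nth_fillS g e kn) /step k1n /gap.
  rewrite (@lambda_step g (Ordinal kn) (Ordinal k1n)) // -[X in (X - _)%N]addnA addKn.
  set i := Ordinal kn; set j := Ordinal k1n; set y := nth _ _ _.
  case: (boolP (i \in HDes g)) => iD; first by apply/orP; left; rewrite muln1; lia.
  rewrite muln0 add0n; set v := (color g i - color g j)%R.
  case: (posnP v) => [v0|v0]; last by apply/orP; left; lia.
  case: (posnP (r * nth 0%N e k)) => re; last by apply/orP; left; lia.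
  apply/orP; right; rewrite v0 re !addn0 eqxx /=.
  move: iD; rewrite inE negb_exists => /forallP /(_ j); rewrite /= eqxx /=.
  have -> : color g i == color g j by rewrite -subr_eq0; apply/eqP/val_inj.
  rewrite -leqNgt leq_eqVlt => /orP[/eqP/val_inj/perm_inj ij|//].
  by have := congr1 val ij; rewrite /= => /eqP; rewrite ltn_eqF.
split; first by rewrite size_mkseq.
  move=> i j ij; have [d] : exists d, j = (i + d.+1)%N :> nat.
    by exists (j - i).-1; lia.
  elim: d j {ij} => [|d IH] j jE.
    have k1n : (i.+1 < n)%N by have := ltn_ord j; lia.
    have := ford _ (ltn_ord i) k1n; rewrite addn1 in jE.
    rewrite (_ : Ordinal k1n = j); last exact: val_inj.
    by rewrite (_ : Ordinal _ = i) ?jE //; apply: val_inj.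
  have kn : (i + d.+1 < n)%N by apply: leq_ltn_trans (ltn_ord j); lia.
  have k1n : ((i + d.+1).+1 < n)%N by rewrite -addnS -jE ltn_ord.
  have := ford _ kn k1n; have /= := IH (Ordinal kn) erefl.
  rewrite (_ : Ordinal k1n = j); last by apply: val_inj; rewrite /= jE !addnS.
  have -> : (i + d.+1).+1 = j by rewrite jE !addnS.
  by lia.
case: (posnP n) => [n0|n_gt0].
  by exists 0%N => i; have := ltn_ord i; rewrite [in X in (_ < X)%N]n0.
have lt_last : (n.-1 < n)%N by rewrite prednK.
pose l := Ordinal lt_last; pose c := color g l : nat.
(* The last entry is c mod r/s plus e_(n-1) r/s, so its shift from c is e_(n-1) - c/(r/s), with
   integer division. Adding s keeps this a natural number and changes the sum by s (r/s) = r. *)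
exists (nth 0%N e n.-1 + (s - c %/ rs))%N => i.
have [d] : exists d, (i + d)%N = n.-1 by exists (n.-1 - i)%N; have := ltn_ord i; lia.
elim: d i => [|d IH] i; last first.
  move=> id; have i1n : (i.+1 < n)%N by have := ltn_ord i; lia.
  pose j := Ordinal i1n; have ji : j = i.+1 :> nat by [].
  rewrite {1}/f nth_fillS // -/f /gap (lambda_step g ji) -[(_ - _)%N]/(_ - lambda s g j)%N.
  rewrite -[X in (X - _)%N]addnA addKn /step i1n.
  set v := (color g i - color g j)%R.
  rewrite [X in (X %% r)%N](_ : _ = (((i \in HDes g) + nth 0%N e i) * r + (v + nth 0%N f j))%N).
    rewrite modnMDl -modnDmr (IH j) ?modnDmr; last by rewrite /=; lia.
    by rewrite addnA -modnDml color_subK modnDml.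
  by rewrite mulnDl /=; lia.
rewrite addn0 => iE.
have -> : i = l by apply: val_inj.
have lN : l.+1 = n by rewrite /= prednK.
rewrite {1}/f nth_fillS // nth_default ?size_mkseq ?lN // add0n /gap lN (lambda_out g (leqnn n)).
rewrite subn0 (lambda_last g lN) -/c /step lN ltnn /=.
have cr : (c %/ rs <= s)%N.
  by rewrite -ltnS ltn_divLR // mulSn mulnC rsE (leq_trans (color_lt _)) ?leq_addl.
have -> : (c + (nth 0 e n.-1 + (s - c %/ rs)) * rs = 1 * r + (c %% rs + rs * nth 0 e n.-1))%N.
  rewrite {1}(divn_eq c rs) -rsE mul1n; move: cr => /subnK /(congr1 (muln^~ rs)).
  by rewrite !mulnDl; lia.
by rewrite modnMDl.
Qed.

End OneSide.

(** * The one-sided series: des, fmaj and col over the denominator *)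

Section OneSideSeries.
Variables r s n N : nat.
Hypotheses (r_gt0 : (0 < r)%N) (s_gt0 : (0 < s)%N) (sr : (s %| r)%N).
Hypothesis n_gt0 : (0 < n)%N.
Let rs := (r %/ s)%N.
Implicit Types (g : colperm r n) (f : seq nat).
Variables vt vq va : 'I_N.

Let rsE : (rs * s = r)%N. Proof. by rewrite divnK. Qed.
Let rs_gt0 : (0 < rs)%N. Proof. by rewrite divn_gt0 // dvdn_leq. Qed.

(** des(g) is the quotient of lambda_1 by r/s rounded up, that is, the least k admissible for lambda
    itself. *)
Lemma des_le g k : (des s g <= k)%N = (lambda s g 0 <= k * rs)%N.
Proof.
rewrite /des -ltnS ltn_divLR //; move: (lambda _ _ _) => x.
have -> : (s * x + r - s = (x + rs - 1) * s)%N by rewrite mulnBl mulnDl rsE mul1n mulnC.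
by rewrite -rsE mulnA ltn_pmul2r // mulSn; lia.
Qed.

Lemma sum_tails (a : nat -> nat) k :
  (\sum_(i < k) \sum_(i <= l < k) a l = \sum_(l < k) l.+1 * a l)%N.
Proof.
elim: k => [|k IH]; first by rewrite !big_ord0.
rewrite !big_ord_recr /= big_nat1 -IH mulSn (addnC (a k)) addnA; congr addn.
rewrite (eq_bigr (fun i : 'I_k => \sum_(i <= l < k) a l + a k)%N) => [|i _]; last first.
  by rewrite big_nat_recr //= ltnW.
by rewrite big_split /= sum_nat_const card_ord.
Qed.

(** Each unit of e_k raises k + 1 entries by [step k], which explains the q-exponent in
    [side_exp]. *)
Lemma sum_fill g e : (\sum_(i < n) nth 0%N (fill s g e) i =
  fmaj s g + \sum_(k < n) k.+1 * step r s n k * nth 0%N e k)%N.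
Proof.
rewrite (eq_bigr (fun i : 'I_n => \sum_(i <= l < n) gap s g l +
    \sum_(i <= l < n) step r s n l * nth 0%N e l)%N); last first.
  by move=> i _; rewrite nth_fill big_split.
rewrite big_split /= !sum_tails [in RHS]/fmaj; congr (_ + _)%N.
  rewrite -sum_tails; apply: eq_bigr => i _.
  by rewrite (lambda_sum r_gt0 s_gt0 sr).
by apply: eq_bigr => i _; rewrite mulnA.
Qed.

Lemma head_fill g e : nth 0%N (fill s g e) 0 =
  (lambda s g 0 + (\sum_(k < n) kstep s n k * nth 0%N e k) * rs)%N.
Proof.
rewrite nth_fill big_split /= (lambda_sum r_gt0 s_gt0 sr); congr addn.
rewrite big_mkord big_distrl /=; apply: eq_bigr => k _.
by rewrite -(stepE n sr k) -mulnA mulnC.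
Qed.

Lemma compatible_col g f :
  compatible s g f -> (\sum_(i < n) nth 0%N f i %% rs = colstat s g)%N.
Proof.
case=> _ _ [b fb]; apply: eq_bigr => i _.
have /(congr1 (modn^~ rs)) := fb i; rewrite !modn_dvdm -?{1}rsE ?dvdn_mulr //.
by rewrite addnC modnMDl.
Qed.

Definition side_set g (x : nat * seq nat) :=
  compatible s g x.2 /\ (nth 0%N x.2 0 <= x.1 * rs)%N.

Definition side_weight (x : nat * seq nat) : 'X_{1..N} :=
  (U_(vt) *+ x.1 + (U_(vq) *+ (\sum_(i < n) nth 0%N x.2 i) +
     U_(va) *+ (\sum_(i < n) nth 0%N x.2 i %% rs)))%MM.

Definition side_exp k : 'X_{1..N} :=
  (U_(vt) *+ kstep s n k + U_(vq) *+ (k.+1 * step r s n k))%MM.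

Lemma side_exp_neq0 k : side_exp k != 0%MM.
Proof.
apply/eqP => /mnmP /(_ vt); rewrite mnm0E mnmDE !mulmnE mnm1E eqxx.
by rewrite /kstep; case: ifP; lia.
Qed.

(** By [head_fill] and [des_le], the bound f_1 <= k r/s reads des(g) + K(e) <= k. The parameters are
    therefore e and the slack e0 in this inequality, the slack giving the factor 1 - t. *)
Lemma is_gf_side_fpsM g : is_gf (side_set g) side_weight
  (fpsM int (U_(vt) *+ des s g + (U_(vq) *+ fmaj s g + U_(va) *+ colstat s g))%MM *
   ((1 - fpsM int U_(vt)%MM)^-1 * \prod_(k < n) (1 - fpsM int (side_exp k))^-1)).
Proof.
pose K (e : seq nat) := (\sum_(k < n) kstep s n k * nth 0%N e k)%N.
have U0 : U_(vt)%MM != 0%MM :> 'X_{1..N} by rewrite mnm1_eq0.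
have M0 k : (k < n)%N -> side_exp k != 0%MM by rewrite side_exp_neq0.
apply: (is_gf_bij (phi := fun x : nat * seq nat => (des s g + x.1 + K x.2, fill s g x.2)%N)
  _ _ _ _ (is_gf_shift _ (is_gf_prod (is_gf_geom U0) (is_gf_exponents M0)))).
- move=> [e0 e] /= [_ se]; split; first exact: fill_compatible.
  rewrite head_fill /= mulnDl leq_add2r mulnDl; apply: leq_trans (leq_addr _ _).
  by rewrite -des_le.
- move=> [e0 e] [e0' e'] /= [_ se] [_ se'] [+ ee'].
  have -> := fill_inj r_gt0 s_gt0 sr se se' ee'.
  by move=> /addIn /addnI ->.
- move=> [k f] [/= cf]; have [e se fE] := compatible_fill r_gt0 s_gt0 sr cf.
  rewrite fE head_fill => fk; have Kk : (K e <= k)%N.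
    by rewrite -(leq_pmul2r rs_gt0); apply: leq_trans fk; rewrite leq_addl.
  have desk : (des s g <= k - K e)%N by rewrite des_le mulnBl; move: fk; rewrite -/(K e); lia.
  exists (k - K e - des s g, e)%N => //=; congr pair.
  by move: (K e) (des s g) Kk desk => x y; lia.
- move=> [e0 e] /= [_ se]; apply/mnmP => v; rewrite /side_weight /=.
  rewrite (compatible_col (fill_compatible r_gt0 s_gt0 sr _ _)).
  rewrite sum_fill !mnmDE !mulmnE mnm_sumE.
  rewrite (eq_bigr (fun k : 'I_n => U_(vt)%MM v * (kstep s n k * nth 0 e k) +
     U_(vq)%MM v * (k.+1 * step r s n k * nth 0 e k))%N) => [|k _].
    by rewrite big_split /= -!big_distrr /= -/(K e); lia.
  by rewrite mulmnE mnmDE !mulmnE mulnDl !mulnA.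
Qed.

Lemma is_gf_side g :
  let T := fpsX int vt in let Q := fpsX int vq in let A := fpsX int va in
  is_gf (side_set g) side_weight (T ^+ des s g * Q ^+ fmaj s g * A ^+ colstat s g /
    ((1 - T) * (1 - T * Q ^+ (n * rs)) *
     \prod_(1 <= j < n) (1 - T ^+ s * Q ^+ (j * r)))).
Proof.
move=> T Q A; have := is_gf_side_fpsM g.
rewrite prodrV => [|k _]; last by rewrite fpsM_unit // side_exp_neq0.
rewrite -invrM ?fpsM_unit ?mnm1_eq0 //; last first.
  by apply: rpred_prod => k _; rewrite fpsM_unit // side_exp_neq0.
rewrite !fpsMD -!fpsXE -/T -/Q -/A mulrA.
have side_expE k : fpsM int (side_exp k) = T ^+ kstep s n k * Q ^+ (k.+1 * step r s n k).
  by rewrite fpsMD -!fpsXE.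
(* The index k = n - 1 carries the step r/s and gives the factor apart; the index j - 1 gives the
   factor j < n. *)
have -> : \prod_(k < n) (1 - fpsM int (side_exp k)) =
    (1 - T * Q ^+ (n * rs)) * \prod_(1 <= j < n) (1 - T ^+ s * Q ^+ (j * r)).
  rewrite -(big_mkord xpredT (fun k => 1 - fpsM int (side_exp k))).
  rewrite (@big_cat_nat _ _ _ n.-1) ?leq_pred //= mulrC.
  rewrite [X in X * _]big_ltn ?ltn_predL // big_geq ?prednK // mulr1.
  rewrite side_expE /kstep /step prednK // ltnn expr1; congr (_ * _).
  rewrite big_add1; apply: eq_big_nat => k /andP[_ kn].
  have k1n : (k.+1 < n)%N by lia.
  by rewrite side_expE /kstep /step k1n.
have -> : fpsM int U_(vt)%MM = T by [].
by rewrite (mulrC _ (1 - T)) (mulrA (1 - T)).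
Qed.

End OneSideSeries.

(** * Cosets of C_s *)

Section Cosets.
Variables r p s n : nat.
Hypotheses (r_gt0 : (0 < r)%N) (s_gt0 : (0 < s)%N) (sr : (s %| r)%N).
Let rs := (r %/ s)%N.
Let C := Cs r s n.
Implicit Types (g h c : colperm r n) (f : seq nat) (x y : coset_of C).

Let rsE : (rs * s = r)%N. Proof. by rewrite divnK. Qed.
Let modr a : (a %% r.-1.+1 = a %% r)%N. Proof. by rewrite prednK. Qed.

Lemma Cs_genX k :
  (Cs_gen r s n ^+ k)%g = ColPerm [ffun=> inZp (k * rs)] 1%g.
Proof.
elim: k => [|k IH].
  by congr ColPerm; apply/ffunP => i; rewrite !ffunE; apply: val_inj; rewrite /= mod0n.
rewrite expgS IH; congr ColPerm; rewrite /= ?mulg1 //.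
by apply/ffunP => i; rewrite !ffunE; apply: val_inj; rewrite /= modnDm mulSn addnC.
Qed.

Lemma Cs_norm g : g \in 'N(C)%g.
Proof.
apply: (fintype.subsetP (cent_sub _)); rewrite /C /Cs cent_cycle.
by apply/cent1P/Cs_gen_central.
Qed.

Lemma compatible_Cs c g f : c \in C -> compatible s g f -> compatible s (c * g)%g f.
Proof.
case/cycleP => k ->; rewrite Cs_genX => -[sf ford [b fb]]; split=> //.
  by move=> i j /ford; rewrite /= mulg1.
(* k (s - 1) stands for -k, since s (r/s) = r. *)
exists (b + k * s.-1)%N => i; rewrite !ffunE /= !modr fb modnDmr modnDml.
apply/eqP; rewrite -addnA eqn_modDl addnC; apply/eqP.
rewrite mulnDl -addnA -mulnDl -mulnSr prednK // -mulnA (mulnC s) rsE.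
by rewrite addnC modnMDl.
Qed.

Lemma repr_coset g : exists2 c, c \in C & repr (coset C g) = (c * g)%g.
Proof.
have /rcosetP[c cC ->] : repr (coset C g) \in (C :* g)%g.
  by rewrite -val_coset ?Cs_norm // mem_repr_coset.
by exists c.
Qed.

Lemma compatible_repr_coset g f :
  compatible s (repr (coset C g)) f <-> compatible s g f.
Proof.
have [c cC ->] := repr_coset g; split; last exact: compatible_Cs.
by rewrite -{2}[g](mulKg c); apply: compatible_Cs; rewrite groupV.
Qed.

Lemma compatible_repr_inv x f :
  compatible s (repr x^-1%g) f <-> compatible s (repr x)^-1%g f.
Proof. by rewrite -{1}[x]coset_reprK -morphV ?Cs_norm //; exact: compatible_repr_coset. Qed.

(** f determines the colours up to a common multiple of r/s, which is exactly the action of C_s. *)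
Lemma compatible_coset_inj x y f : compatible s (repr x) f -> compatible s (repr y) f ->
  under (repr x) = under (repr y) -> x = y.
Proof.
case=> _ _ [b fb] [_ _ [b' fb']] uxy.
rewrite -[x]coset_reprK -[y]coset_reprK.
have -> : repr x = ((Cs_gen r s n) ^+ (b' + b * s.-1) * repr y)%g.
  rewrite Cs_genX; case: (repr x) (repr y) uxy fb fb' => [cx ux] [cy uy] /= -> fb fb'.
  congr ColPerm; last by rewrite mulg1.
  apply/ffunP => i; rewrite !ffunE; apply: val_inj; rewrite /= !modr modnDmr.
  rewrite -[LHS](modn_small (color_lt r_gt0 _)); apply/eqP.
  rewrite -(eqn_modDr (b * rs)) -fb fb' -addnA -mulnDl -addnA -mulnSr (prednK s_gt0).
  by rewrite mulnDl -mulnA (mulnC s) rsE addnA [in eqbRHS]addnC modnMDl.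
by rewrite mkerl ?Cs_norm ?mem_cycle // ker_coset mem_cycle.
Qed.

(** Modulo p, the sum of f is the sum of the colours plus b n r/s, and the latter vanishes. *)
Lemma mem_Grpn_compatible g f : (p %| r)%N -> (p %| n * rs)%N -> compatible s g f ->
  (g \in Grpn r p n) = (p %| \sum_(i < n) nth 0%N f i)%N.
Proof.
move=> pr pn [_ _ [b fb]]; rewrite inE /dvdn.
have -> : (\sum_(i < n) nth 0 f i = b * (n * rs) + \sum_(i < n) color g i %[mod p])%N.
  rewrite mulnCA -[X in (X * _)%N](card_ord n) -sum_nat_const -big_split /=.
  rewrite -[LHS]modn_summ -[RHS]modn_summ; congr (_ %% p)%N; apply: eq_bigr => i _.
  by have /(congr1 (modn^~ p)) := fb i; rewrite !modn_dvdm // addnC.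
by rewrite -modnDml (eqP (dvdn_mull b pn)) add0n.
Qed.

Lemma mem_Grpsn_compatible x f : (p %| r)%N -> (p %| n * rs)%N ->
  compatible s (repr x) f ->
  (x \in Grpsn r p s n) = (p %| \sum_(i < n) nth 0%N f i)%N.
Proof.
move=> pr pn cf; apply/idP/idP => [|pf].
  case/morphimP => y yN yG xE; rewrite -(mem_Grpn_compatible pr pn (g := y)) //.
  by apply/compatible_repr_coset; rewrite -xE.
rewrite -[x]coset_reprK; apply: mem_morphim; first exact: Cs_norm.
by rewrite (mem_Grpn_compatible pr pn cf).
Qed.

End Cosets.

(** * Pairs of compatible sequences and sorted lists of pairs *)

Definition gelex (a b : nat * nat) : bool :=
  (b.1 < a.1)%N || (a.1 == b.1) && (b.2 <= a.2)%N.

Lemma gelex_total : total gelex.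
Proof. by move=> a b; rewrite /gelex; lia. Qed.
Lemma gelex_trans : transitive gelex.
Proof. by move=> a b c; rewrite /gelex; lia. Qed.
Lemma gelex_anti : antisymmetric gelex.
Proof. by move=> [a b] [c d]; rewrite /gelex /= => ?; congr pair; lia. Qed.

(** * Stable sorting permutations *)

Section Ranks.
Variables (n : nat).
Implicit Types (i j : 'I_n) (b : 'I_n -> nat).

(* The sorting permutation of b: decreasing values, ties kept in order. *)
Definition before b j i := (b i < b j)%N || (b i == b j) && (j < i)%N.
Definition rank b i := (\sum_(j < n | before b j i) 1)%N.

Lemma rank_lt b i : (rank b i < n)%N.
Proof.
rewrite -[X in (_ < X)%N](card_ord n) -sum1_card (bigD1 i) //= add1n ltnS /rank.
rewrite big_mkcond [X in (_ <= X)%N]big_mkcond; apply: leq_sum => j _.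
by rewrite /before; case: (eqVneq j i) => [->|_]; rewrite ?ltnn ?eqxx //; case: ifP.
Qed.

Lemma before_rank b i j : before b j i -> (rank b j < rank b i)%N.
Proof.
move=> ji; rewrite /rank [X in (_ < X)%N](bigD1 j) //= add1n ltnS.
rewrite big_mkcond [X in (_ <= X)%N]big_mkcond; apply: leq_sum => k _.
have [kj|] := boolP (before b k j); last by case: ifP.
rewrite ifT //; move: ji kj; rewrite /before.
by case: (eqVneq k j) => [->|_]; lia.
Qed.

Lemma before_total b i j : i != j -> before b i j || before b j i.
Proof. by rewrite /before -(inj_eq (@ord_inj n)); lia. Qed.

Lemma rank_inj b : injective (fun i => Ordinal (rank_lt b i)).
Proof.
move=> i j /(congr1 val) /= ij; apply/eqP; apply: contraT => /(before_total b).
by case/orP => /before_rank; rewrite ij ltnn.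
Qed.

Definition rank_perm b : 'S_n := perm (@rank_inj b).

Lemma rank_permP b i j : (rank_perm b j < rank_perm b i)%N = before b j i.
Proof.
rewrite !permE /=; apply/idP/idP => [|/before_rank //].
have [->|/(before_total b)/orP[//|/before_rank ij ji]] := eqVneq j i.
  by rewrite ltnn.
by have := ltn_trans ij ji; rewrite ltnn.
Qed.

(** One implication suffices because [before] is a strict total order; then u i, the number of j
    with u j < u i, is the rank of i. *)
Lemma perm_rank b (u : 'S_n) :
  (forall i j, (u j < u i)%N -> before b j i) -> u = rank_perm b.
Proof.
move=> ub; apply/permP => i; apply: val_inj; rewrite permE /=.
have uE j : before b j i = (u j < u i)%N.
  apply/idP/idP => [ji|/ub //]; rewrite ltnNge leq_eqVlt; apply/negP.
  case/orP => [/eqP/val_inj/perm_inj ij|/ub]; move: ji; rewrite ?ij /before; lia.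
have -> : rank b i = (\sum_(k < n | (k < u i)%N) 1)%N.
  by rewrite /rank (eq_bigl _ _ uE) [RHS](reindex_inj (@perm_inj _ u)).
by rewrite -(big_ord_widen _ (fun=> 1%N)) ?sum1_card ?card_ord // ltnW.
Qed.

End Ranks.

(** * The correspondence between pairs of sequences and sorted lists *)

Section Bijection.
Variables r s n : nat.
Let rs := (r %/ s)%N.
Implicit Types (g h : colperm r n) (f : seq nat) (i j : 'I_n).

Definition pairing (u : 'S_n) f f' : seq (nat * nat) :=
  [seq (nth 0%N f i, nth 0%N f' (u i)) | i <- enum 'I_n].

Lemma nth_pairing u f f' i :
  nth (0, 0)%N (pairing u f f') i = (nth 0%N f i, nth 0%N f' (u i)).
Proof. by rewrite (nth_map i) ?size_enum_ord // nth_ord_enum. Qed.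

Lemma size_pairing u f f' : size (pairing u f f') = n.
Proof. by rewrite size_map size_enum_ord. Qed.

Lemma compatible_head (n_gt0 : (0 < n)%N) g f i :
  compatible s g f -> (nth 0%N f i <= nth 0%N f 0)%N.
Proof.
case=> _ ford _; case: (posnP i) => [->//|i0].
by have /= := ford (Ordinal n_gt0) i i0; lia.
Qed.

(** Where f ties, sigma increases, so the compatibility of f' with g^-1 makes the second entries
    weakly decrease. *)
Lemma pairing_sorted g f f' : compatible s g f -> compatible s g^-1%g f' ->
  sorted gelex (pairing (under g) f f').
Proof.
case=> _ ford _ [_ ford' _]; apply/(sortedP (0, 0)%N) => k.
rewrite size_pairing => k1n; pose i := Ordinal (ltnW k1n); pose j := Ordinal k1n.
rewrite (nth_pairing _ _ _ i) (nth_pairing _ _ _ j) /gelex /=.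
have /= /orP[->//|/andP[-> /ford' /orP[/ltnW ->|/andP[/eqP -> _]]]] := ford i j (leqnn _).
  by rewrite orbT.
by rewrite leqnn orbT.
Qed.

(** Compatibility of f' with g^-1 says that sigma stably sorts the second entries, so the list alone
    determines sigma by [perm_rank], and then f and f'. *)
Lemma pairing_inj g h f f' e e' : compatible s g f -> compatible s g^-1%g f' ->
  compatible s h e -> compatible s h^-1%g e' ->
  pairing (under g) f f' = pairing (under h) e e' ->
  [/\ f = e, f' = e' & under g = under h].
Proof.
move=> [sf ford _] [sf' ford' _] [se eord _] [se' eord' _] E.
have Ei i : (nth 0%N f i, nth 0%N f' (under g i)) = (nth 0%N e i, nth 0%N e' (under h i)).
  by rewrite -!nth_pairing E.
pose b i := nth 0%N f' (under g i).
have gE : under g = rank_perm b.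
  by apply: perm_rank => i j /ford'; rewrite /= !permK eq_sym.
have hE : under h = rank_perm b.
  apply: perm_rank => i j /eord'; rewrite /= !permK eq_sym /before /b.
  by have [_ ->] := Ei i; have [_ ->] := Ei j.
have gh : under g = under h by rewrite gE hE.
split=> //; apply: (@eq_from_nth _ 0%N); rewrite ?sf ?sf' ?se ?se' // => k kn.
  by have [] := Ei (Ordinal kn).
by have [_] := Ei ((under g)^-1 (Ordinal kn))%g; rewrite -gh permKV.
Qed.

Hypothesis r_gt0 : (0 < r)%N.

Lemma color_inv g i : (color g i + color g^-1%g (under g i) = 0 %[mod r])%N.
Proof.
rewrite ffunE permK; move: (color g i) => c.
have modr a : (a %% r.-1.+1 = a %% r)%N by rewrite prednK.
by have /(congr1 val) := subrr c; rewrite /= !modr modnDmr mod0n.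
Qed.

Lemma pairing_surj S l : size S = n -> sorted gelex S ->
  (forall a, a \in S -> a.1 + a.2 = l * rs %[mod r])%N ->
  exists g f f', [/\ compatible s g f, compatible s g^-1%g f' &
                     pairing (under g) f f' = S].
Proof.
move=> sS oS mS; pose a i := (nth (0, 0)%N S i).1; pose b i := (nth (0, 0)%N S i).2.
pose u := rank_perm b.
pose g : colperm r n := ColPerm [ffun i => inZp (a i)] u.
pose f := mkseq (fun k => (nth (0, 0)%N S k).1) n.
pose f' := [seq b (u^-1 i)%g | i <- enum 'I_n].
have fE i : nth 0%N f i = a i by rewrite nth_mkseq.
have f'E i : nth 0%N f' i = b (u^-1 i)%g.
  by rewrite (nth_map i) ?size_enum_ord // nth_ord_enum.
have cE i : (color g i = a i %% r :> nat)%N by rewrite ffunE /= prednK.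
exists g, f, f'; split.
- split; first by rewrite size_mkseq.
  + move=> i j ij; rewrite !fE.
    have : gelex (nth (0, 0)%N S i) (nth (0, 0)%N S j).
      by apply: (sorted_ltn_nth gelex_trans) => //; rewrite inE sS.
    rewrite /gelex -/(a i) -/(a j) -/(b i) -/(b j) => /orP[->//|/andP[-> ba]].
    by move: ba; rewrite /= rank_permP /before ij; lia.
  + by exists 0%N => i; rewrite fE cE addn0 modn_mod.
- split; first by rewrite size_map size_enum_ord.
  + move=> i j ij; rewrite !f'E /=.
    have : (u (u^-1 i)%g < u (u^-1 j)%g)%N by rewrite !permKV.
    by rewrite rank_permP /before eq_sym.
  (* The colours of g^-1 are opposite to those of g ([color_inv]), so the common sum l r/s makes l
     the shift for f'. *)
  + exists l => i; rewrite f'E; set j := (u^-1 i)%g.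
    have ij : i = under g j by rewrite /= permKV.
    have Sj : nth (0, 0)%N S j \in S by rewrite mem_nth // sS.
    apply/eqP; rewrite -(eqn_modDl (color g j)) addnA -[in eqbRHS]modnDml.
    rewrite ij color_inv modnDml add0n cE modnDml; apply/eqP; exact: mS.
- apply: (@eq_from_nth _ (0, 0)%N); rewrite size_pairing ?sS // => k kn.
  rewrite (nth_pairing _ _ _ (Ordinal kn)) fE f'E permK /a /b /=.
  by case: nth.
Qed.

Hypotheses (s_gt0 : (0 < s)%N) (sr : (s %| r)%N).
Let rsE : (rs * s = r)%N. Proof. by rewrite divnK. Qed.

(** The colours cancel by [color_inv], leaving (b + b') r/s, where only b + b' modulo s matters. *)
Lemma pairing_mod g f f' : compatible s g f -> compatible s g^-1%g f' ->
  exists2 l, (l < s)%N & forall i,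
    (nth 0%N f i + nth 0%N f' (under g i) = l * rs %[mod r])%N.
Proof.
case=> _ _ [b fb] [_ _ [b' fb']]; exists ((b + b') %% s)%N; first by rewrite ltn_mod.
move=> i; rewrite -modnDm fb fb' modnDm addnACA -modnDml color_inv modnDml.
rewrite add0n -mulnDl {1}(divn_eq (b + b') s) mulnDl -mulnA (mulnC s) rsE.
by rewrite modnMDl.
Qed.

End Bijection.

(** * Comparison of the two sides *)

Section Assembly.
Variables r p s : nat.
Let rs := (r %/ s)%N.
Let d := ((s * p) %/ gcdn (s * p) r)%N.

Definition pair_weight (a : nat * nat) : 'X_{1..7} :=
  (U_(var_u) + (U_(var_q1) *+ a.1 + U_(var_a1) *+ (a.1 %% rs)) +
   (U_(var_q2) *+ a.2 + U_(var_a2) *+ (a.2 %% rs)))%MM.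

Definition word_weight (k : nat * nat) (y : nat * seq (nat * nat)) : 'X_{1..7} :=
  (U_(var_t1) *+ k.1 + U_(var_t2) *+ k.2 + \big[mnm_add/0%MM]_(a <- y.2) pair_weight a)%MM.

Definition cell (k : nat * nat) l (a : nat * nat) : bool :=
  [&& (a.1 <= k.1 * rs)%N, (a.2 <= k.2 * rs)%N & (a.1 + a.2 == l * rs %[mod r])%N].

(** The residue l belongs to the word: a nonempty list determines it, but the empty list admits all
    s values, whence the numerator s in [is_gf_size0]. *)
Definition word_set (k : nat * nat) (y : nat * seq (nat * nat)) : Prop :=
  [/\ (y.1 < s)%N, sorted gelex y.2 & {in y.2, forall a, cell k y.1 a}].

Lemma word_weight_u k y : word_weight k y var_u = size y.2.
Proof.
rewrite /word_weight !mnmDE !mulmnE !mnm1E mnm_sumE /= -sum1_size.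
by apply: eq_bigr => a _; rewrite /pair_weight !mnmDE !mulmnE !mnm1E.
Qed.

Lemma word_weight_q1 k y : word_weight k y var_q1 = (\sum_(a <- y.2) a.1)%N.
Proof.
rewrite /word_weight !mnmDE !mulmnE !mnm1E mnm_sumE /=.
by apply: eq_bigr => a _; rewrite /pair_weight !mnmDE !mulmnE !mnm1E /= mul1n !mul0n !addn0.
Qed.

Lemma word_weight_t k y : (word_weight k y var_t1, word_weight k y var_t2) = k.
Proof.
case: k => k1 k2; rewrite /word_weight !mnmDE !mulmnE !mnm1E !mnm_sumE /=.
rewrite !big1; first by rewrite !mul1n !mul0n !addn0.
all: by move=> a _; rewrite /pair_weight !mnmDE !mulmnE !mnm1E.
Qed.

Lemma is_gf_words k l : is_gf
  (fun S : seq (nat * nat) => sorted gelex S /\ {in S, forall a, cell k l a})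
  (fun S => \big[mnm_add/0%MM]_(a <- S) pair_weight a)
  (\prod_(i < (k.1 * rs).+1)
     \prod_(j < (k.2 * rs).+1 | (i + j == l * rs %[mod r])%N)
        (1 - u_ * a1_ ^+ (i %% rs) * a2_ ^+ (j %% rs) * q1_ ^+ i * q2_ ^+ j)^-1).
Proof.
pose J := [seq a <- [seq (i, j) | i <- iota 0 (k.1 * rs).+1, j <- iota 0 (k.2 * rs).+1]
  | cell k l a].
have JE a : (a \in J) = cell k l a.
  rewrite mem_filter; apply: andb_idr => /and3P[a1 a2 _].
  by apply/allpairsP; exists a; rewrite !mem_iota !add0n !ltnS; split=> //; case: a {a1 a2}.
have -> : (\prod_(i < (k.1 * rs).+1)
     \prod_(j < (k.2 * rs).+1 | (i + j == l * rs %[mod r])%N)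
        (1 - u_ * a1_ ^+ (i %% rs) * a2_ ^+ (j %% rs) * q1_ ^+ i * q2_ ^+ j)^-1) =
  \prod_(a <- J) (1 - fpsM int (pair_weight a))^-1.
  rewrite big_filter [RHS]big_mkcond big_allpairs.
  rewrite -[iota 0 (k.1 * rs).+1]/(index_iota 0 (k.1 * rs).+1) big_mkord.
  apply: eq_bigr => i _; rewrite -[iota 0 (k.2 * rs).+1]/(index_iota 0 (k.2 * rs).+1).
  rewrite big_mkord big_mkcond.
  apply: eq_bigr => j _; rewrite /cell /= -ltnS ltn_ord -ltnS ltn_ord /=.
  case: ifP => // _; rewrite /pair_weight /= !fpsMD -!fpsXE.
  have -> : fpsM int U_(var_u)%MM = u_ by [].
  rewrite -/q1_ -/q2_ -/a1_ -/a2_; congr ((1 - _)^-1); ring.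
apply: is_gf_ext (is_gf_msets (le := gelex) (M := pair_weight) (J := J) _ _ _ _ _) => //.
- by move=> S; split=> -[oS SJ]; split=> // a /SJ; rewrite JE.
- exact: gelex_total.
- exact: gelex_trans.
- exact: gelex_anti.
- apply/filter_uniq/allpairs_uniq; rewrite ?iota_uniq //.
  by move=> [? ?] [? ?] _ _ /= [-> ->].
- move=> a _; apply/eqP => /mnmP /(_ var_u).
  by rewrite /pair_weight !mnmDE !mulmnE !mnm1E mnm0E.
Qed.

(** The exponents of t1 and t2 recover k, which controls the infinite sum; those of u and q1 are the
    length and the sum of first entries, so the restriction becomes a condition on words. *)
Lemma is_gf_lhs : is_gf
  (fun x : (nat * nat) * (nat * seq (nat * nat)) =>
     word_set x.1 x.2 /\ (d %| size x.2.2)%N && (p %| \sum_(a <- x.2.2) a.1)%N)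
  (fun x => word_weight x.1 x.2)
  (restrict_uq1 d p (fps_sum [set: nat * nat]%classic (fun k =>
       t1_ ^+ k.1 * t2_ ^+ k.2 *
       \sum_(l < s)
         \prod_(i < (k.1 * rs).+1)
           \prod_(j < (k.2 * rs).+1 | (i + j == l * rs %[mod r])%N)
             (1 - u_ * a1_ ^+ (i %% rs) * a2_ ^+ (j %% rs) * q1_ ^+ i * q2_ ^+ j)^-1))).
Proof.
apply: (is_gf_ext (A := fun x : (nat * nat) * (nat * seq (nat * nat)) =>
    ([set: nat * nat]%classic x.1 /\ word_set x.1 x.2) /\
    (d %| word_weight x.1 x.2 var_u)%N && (p %| word_weight x.1 x.2 var_q1)%N)).
- by move=> x; rewrite word_weight_u word_weight_q1; split=> [[[_ ? ?]]|[? ?]].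
- by [].
apply: (@is_gf_filter _ _ _ _ (fun m : 'X_{1..7} => (d %| m var_u)%N && (p %| m var_q1)%N)).
apply: (is_gf_fps_sum (kappa := fun m : 'X_{1..7} => (m var_t1, m var_t2))).
  move=> k _; rewrite !fpsXE -fpsMD; apply: is_gf_shift.
  rewrite -(big_mkord xpredT (fun l => \prod_(i < (k.1 * rs).+1)
     \prod_(j < (k.2 * rs).+1 | (i + j == l * rs %[mod r])%N)
        (1 - u_ * a1_ ^+ (i %% rs) * a2_ ^+ (j %% rs) * q1_ ^+ i * q2_ ^+ j)^-1)).
  apply: is_gf_ext (is_gf_sum (iota_uniq 0 (s - 0)) (fun l _ => is_gf_words k l)) => //.
  move=> [l S]; rewrite mem_index_iota /=.
  by split=> [[? []]|[]].
by move=> k y _; exact: word_weight_t.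
Qed.

Definition words_of_size n (x : (nat * nat) * (nat * seq (nat * nat))) : Prop :=
  [/\ word_set x.1 x.2, size x.2.2 = n & (p %| \sum_(a <- x.2.2) a.1)%N].

Lemma is_gf_size0 : is_gf (words_of_size 0) (fun x => word_weight x.1 x.2)
  (s%:R / ((1 - t1_) * (1 - t2_))).
Proof.
have gf_s : is_gf (fun y : nat * unit => y.1 \in iota 0 s /\ y.2 = tt)
    (fun=> 0%MM : 'X_{1..7}) s%:R.
  have <- : \sum_(l <- iota 0 s) (fpsM int 0%MM : fps 7 int) = s%:R.
    by rewrite fpsM0 big_const_seq count_predT size_iota iter_addr_0.
  by apply: (is_gf_sum (iota_uniq 0 s) (fun l _ => is_gf1 tt (fun=> 0%MM))).
have gf_t (v : 'I_7) : is_gf (fun _ : nat => True) (fun k => U_(v) *+ k)%MM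
    (1 - fpsX int v)^-1.
  by apply: is_gf_geom; rewrite mnm1_eq0.
have U (v : 'I_7) : 1 - fpsX int v \is a GRing.unit.
  by apply: fpsM_unit; rewrite mnm1_eq0.
rewrite invrM ?U // [_ * (1 - t1_)^-1]mulrC.
apply: (is_gf_bij (phi := fun y : (nat * unit) * (nat * nat) => (y.2, (y.1.1, [::])))
  _ _ _ _ (is_gf_prod gf_s (is_gf_prod (gf_t var_t1) (gf_t var_t2)))).
- by move=> [[l []] k] /= [[+ _] _]; rewrite mem_iota => ls; split; rewrite ?big_nil.
- by move=> [[l []] k] [[l' []] k'] /= _ _ [-> ->].
- move=> [k [l S]] [/= [ls _ _] /size0nil -> _]; exists ((l, tt), k) => //=.
  by rewrite mem_iota.
- by move=> [[l []] k] _; rewrite /word_weight /= big_nil; apply/mnmP => v; rewrite !mnmDE mnm0E; lia.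
Qed.

(** * Words of positive length *)

Section PositiveSize.
Variable n : nat.
Hypotheses (r_gt0 : (0 < r)%N) (s_gt0 : (0 < s)%N).
Hypotheses (sr : (s %| r)%N) (pr : (p %| r)%N).
Hypotheses (n_gt0 : (0 < n)%N) (dn : (d %| n)%N).
Let C := Cs r s n.

Let rsE : (rs * s = r)%N. Proof. by rewrite divnK. Qed.
Let rs_gt0 : (0 < rs)%N. Proof. by rewrite divn_gt0 // dvdn_leq. Qed.

(** Since s p = d gcd(s p, r), with d dividing n and the gcd dividing r, s p divides n r = s n
    (r/s); then s cancels. *)
Let pn : (p %| n * rs)%N.
Proof.
have : (s * p %| n * r)%N.
  have spE := divnK (dvdn_gcdl (s * p) r).
  have -> : (n * r = (n * (r %/ gcdn (s * p) r)) * gcdn (s * p) r)%N.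
    by rewrite -mulnA divnK ?dvdn_gcdr.
  by rewrite -[X in (X %| _)%N]spE dvdn_pmul2r ?gcdn_gt0 ?r_gt0 ?orbT // dvdn_mulr.
by rewrite -rsE mulnA (mulnC _ s) dvdn_pmul2l.
Qed.

Definition side1 := side_weight r s n var_t1 var_q1 var_a1.
Definition side2 := side_weight r s n var_t2 var_q2 var_a2.

Definition sides_set (z : coset_of C * ((nat * seq nat) * (nat * seq nat))) : Prop :=
  z.1 \in Grpsn r p s n /\
  (side_set s (repr z.1) z.2.1 /\ side_set s (repr z.1^-1%g) z.2.2).

Definition sides_weight (z : coset_of C * ((nat * seq nat) * (nat * seq nat))) :=
  (U_(var_u) *+ n + (side1 z.2.1 + side2 z.2.2))%MM.

Lemma is_gf_sides : is_gf sides_set sides_weight (u_ ^+ n *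
      ((\sum_(g in Grpsn r p s n)
          t1_ ^+ Gdes g * t2_ ^+ Gdes g^-1%g
          * q1_ ^+ Gfmaj g * q2_ ^+ Gfmaj g^-1%g
          * a1_ ^+ Gcol g * a2_ ^+ Gcol g^-1%g)
      / ((1 - t1_) * (1 - t2_)
         * (1 - t1_ * q1_ ^+ (n * rs)) * (1 - t2_ * q2_ ^+ (n * rs))
         * \prod_(1 <= j < n)
             ((1 - t1_ ^+ s * q1_ ^+ (j * r)) * (1 - t2_ ^+ s * q2_ ^+ (j * r)))))).
Proof.
rewrite fpsXE; apply: is_gf_shift.
have U (v w : 'I_7) e k : (0 < e)%N -> 1 - fpsX int v ^+ e * fpsX int w ^+ k \is a GRing.unit.
  move=> e0; rewrite !fpsXE -fpsMD; apply: fpsM_unit.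
  apply/eqP => /mnmP /(_ v); rewrite mnm0E mnmDE !mulmnE mnm1E eqxx mul1n.
  by move/eqP; rewrite addn_eq0 gtn_eqF.
have Ut (v : 'I_7) : 1 - fpsX int v \is a GRing.unit.
  by have := U v v 1%N 0%N isT; rewrite expr0 mulr1 expr1.
have UD (v w : 'I_7) : (1 - fpsX int v) * (1 - fpsX int v * fpsX int w ^+ (n * rs)) *
    \prod_(1 <= j < n) (1 - fpsX int v ^+ s * fpsX int w ^+ (j * r)) \is a GRing.unit.
  rewrite !unitrM Ut (U v w 1%N) //=; apply: rpred_prod => j _; exact: U.
have term (N1 N2 N3 N4 N5 N6 D1 D2 : fps 7 int) :
    D1 \is a GRing.unit -> D2 \is a GRing.unit ->
    N1 * N2 * N3 * N4 * N5 * N6 / (D1 * D2) = (N1 * N3 * N5 / D1) * (N2 * N4 * N6 / D2).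
  by move=> u1 u2; rewrite invrM //; ring.
rewrite mulr_suml -big_enum /= big_split /=.
rewrite (_ : forall x y z t v w : fps 7 int,
  x * y * z * t * (v * w) = (x * z * v) * (y * t * w)); last by move=> *; ring.
under eq_bigr do rewrite term ?UD //.
apply: is_gf_ext (is_gf_sum (enum_uniq (Grpsn r p s n)) (fun g _ =>
  is_gf_prod (is_gf_side r_gt0 s_gt0 sr n_gt0 var_t1 var_q1 var_a1 (repr g))
             (is_gf_side r_gt0 s_gt0 sr n_gt0 var_t2 var_q2 var_a2 (repr g^-1%g)))) => //.
by move=> [x [y1 y2]]; rewrite mem_enum.
Qed.

(** By [pairing_mod] all pairs have the same sum modulo r, so l can be read off the first one, which
    exists as n > 0. *)
Definition sides_word (z : coset_of C * ((nat * seq nat) * (nat * seq nat))) :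
    (nat * nat) * (nat * seq (nat * nat)) :=
  let S := pairing (under (repr z.1)) z.2.1.2 z.2.2.2 in
  let a := nth (0, 0)%N S 0 in
  ((z.2.1.1, z.2.2.1), ((a.1 + a.2) %% r %/ rs, S))%N.

Let sides_compatible z : sides_set z ->
  compatible s (repr z.1) z.2.1.2 /\ compatible s (repr z.1)^-1%g z.2.2.2.
Proof. by case=> _ [[c1 _] [/(compatible_repr_inv r_gt0 s_gt0 sr) c2 _]]. Qed.

Let sum_pairing1 (u : 'S_n) f f' :
  (\sum_(a <- pairing u f f') a.1 = \sum_(i < n) nth 0%N f i)%N.
Proof. by rewrite big_map big_enum. Qed.

Lemma sides_word_set z : sides_set z -> words_of_size n (sides_word z).
Proof.
move=> zS; have [c1 c2] := sides_compatible zS; move: zS => [zG [[_ h1] [_ h2]]].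
have [l ls lE] := pairing_mod r_gt0 s_gt0 sr c1 c2.
have lrs : (l * rs < r)%N by rewrite -rsE mulnC ltn_pmul2l.
have aE : (sides_word z).2.1 = l.
  rewrite /= (nth_pairing _ _ _ (Ordinal n_gt0)) lE modn_small // mulnK //.
split; [split | exact: size_pairing |]; rewrite ?aE //.
- exact: (pairing_sorted c1 c2).
- move=> _ /mapP[i _ ->]; rewrite /cell /= lE eqxx andbT.
  rewrite (leq_trans (compatible_head n_gt0 i c1) h1).
  by rewrite (leq_trans (compatible_head n_gt0 (under (repr z.1) i) c2) h2).
- by rewrite sum_pairing1 -(mem_Grpsn_compatible r_gt0 s_gt0 sr pr pn c1).
Qed.

Lemma sides_word_inj z z' : sides_set z -> sides_set z' ->
  sides_word z = sides_word z' -> z = z'.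
Proof.
move=> /sides_compatible[c1 c2] /sides_compatible[c1' c2'] [k1 k2 _ SE].
have [f1 f2 uE] := pairing_inj c1 c2 c1' c2' SE.
case: z z' c1 c2 c1' c2' k1 k2 f1 f2 uE {SE}
  => [x [[k1 f1] [k2 f2]]] [x' [[k1' f1'] [k2' f2']]] /= c1 c2 c1' c2' -> -> ef1 -> uE.
rewrite -ef1 in c1' *; congr pair.
exact: (compatible_coset_inj r_gt0 s_gt0 sr c1 c1' uE).
Qed.

Lemma sides_word_surj y : words_of_size n y -> exists2 z, sides_set z & sides_word z = y.
Proof.
case: y => [[k1 k2] [l S]] [/= [/= ls oS SJ] sS pS].
have [a /SJ /and3P[_ _ /eqP //]|g [f [f' [c1 c2 SE]]]] :=
  pairing_surj r_gt0 sS oS (l := l) (s := s).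
have lrs : (l * rs < r)%N by rewrite -rsE mulnC ltn_pmul2l.
have c1' : compatible s (repr (coset C g)) f.
  by apply/(compatible_repr_coset r_gt0 s_gt0 sr).
have c2' : compatible s (repr (coset C g)^-1%g) f'.
  rewrite -morphV ?Cs_norm //.
  by apply/(compatible_repr_coset r_gt0 s_gt0 sr).
have uE : under (repr (coset C g)) = under g.
  have [c cC ->] := repr_coset s g.
  by case/cycleP: cC => k ->; rewrite Cs_genX //= mulg1.
have inS (i : 'I_n) : (nth 0%N f i, nth 0%N f' (under g i)) \in S.
  by rewrite -SE -nth_pairing mem_nth // size_pairing.
exists (coset C g, ((k1, f), (k2, f'))).
  split.
    by rewrite (mem_Grpsn_compatible r_gt0 s_gt0 sr pr pn c1') -(sum_pairing1 (under g) f f') SE.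
  split; split=> //=.
    by have /SJ/and3P[] := inS (Ordinal n_gt0).
  (* The first entry of f' occurs in the list at the position that sigma sends to the first
     index. *)
  by have /SJ/and3P[_] := inS ((under g)^-1 (Ordinal n_gt0))%g; rewrite /= permKV.
rewrite /sides_word /= uE SE; congr (_, (_, _)).
have /SJ/and3P[_ _ /eqP ->] : nth (0, 0)%N S 0 \in S by rewrite mem_nth // sS.
by rewrite modn_small // mulnK.
Qed.

Lemma sides_word_weight z : sides_set z ->
  word_weight (sides_word z).1 (sides_word z).2 = sides_weight z.
Proof.
case: z => [x [[k1 f] [k2 f']]] _; rewrite /sides_word /= /word_weight /sides_weight /=.
rewrite /side1 /side2 /side_weight /= big_map big_enum /=; set w := under _.
apply/mnmP => v; rewrite !mnmDE !mulmnE mnm_sumE /= -/rs.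
under eq_bigr => i _ do rewrite /pair_weight !mnmDE !mulmnE /=.
rewrite !big_split /= -!big_distrr /= sum_nat_const card_ord.
have E (F : nat -> nat) : (\sum_(i < n) F (nth 0 f' (w i)) = \sum_(i < n) F (nth 0 f' i))%N.
  by rewrite [RHS](reindex_inj (@perm_inj _ w)).
have /= -> := E id; have /= -> := E (modn^~ rs).
have IE (F : 'I_n -> nat) : (\sum_(i in 'I_n) F i = \sum_(i < n) F i)%N by exact: eq_bigl.
rewrite !IE.
move: (\sum_(i < n) nth 0 f i)%N (\sum_(i < n) nth 0 f i %% rs)%N
  (\sum_(i < n) nth 0 f' i)%N => x1 x2 x3.
by lia.
Qed.

Lemma is_gf_size_pos :
  is_gf (words_of_size n) (fun x => word_weight x.1 x.2) (u_ ^+ n *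
      ((\sum_(g in Grpsn r p s n)
          t1_ ^+ Gdes g * t2_ ^+ Gdes g^-1%g
          * q1_ ^+ Gfmaj g * q2_ ^+ Gfmaj g^-1%g
          * a1_ ^+ Gcol g * a2_ ^+ Gcol g^-1%g)
      / ((1 - t1_) * (1 - t2_)
         * (1 - t1_ * q1_ ^+ (n * rs)) * (1 - t2_ * q2_ ^+ (n * rs))
         * \prod_(1 <= j < n)
             ((1 - t1_ ^+ s * q1_ ^+ (j * r)) * (1 - t2_ ^+ s * q2_ ^+ (j * r)))))).
Proof.
exact: (is_gf_bij sides_word_set sides_word_inj sides_word_surj sides_word_weight is_gf_sides).
Qed.

End PositiveSize.

End Assembly.

(* For n = 0 the displayed fraction is degenerate (lambda_1, hence des, does *)
(* not exist, and the denominator would be (1 - t1)^2 (1 - t2)^2). It stands *)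
(* for the only value compatible with the terms of degree 0 in u of the      *)
(* left-hand side, s / ((1 - t1) (1 - t2)); for s = 1 this is the usual      *)
(* 1 / ((1 - t1) (1 - t2)).                                                  *)
Theorem theorem6p4 (r p s : nat) (hr : (0 < r)%N) (hp : (0 < p)%N) (hs : (0 < s)%N)
    (hsr : (s %| r)%N) (hpr : (p %| r)%N) :
  let d := ((s * p) %/ gcdn (s * p) r)%N in
  let rs := (r %/ s)%N in
  restrict_uq1 d p
    (fps_sum [set: nat * nat]%classic (fun k =>
       t1_ ^+ k.1 * t2_ ^+ k.2 *
       \sum_(l < s)
         \prod_(i < (k.1 * rs).+1)
           \prod_(j < (k.2 * rs).+1 | (i + j == l * rs %[mod r])%N)
             (1 - u_ * a1_ ^+ (i %% rs) * a2_ ^+ (j %% rs) * q1_ ^+ i * q2_ ^+ j)^-1))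
  = fps_sum [set n | (d %| n)%N]%classic (fun n => u_ ^+ n *
      if n == 0%N then s%:R / ((1 - t1_) * (1 - t2_)) else
      (\sum_(g in Grpsn r p s n)
          t1_ ^+ Gdes g * t2_ ^+ Gdes g^-1%g
          * q1_ ^+ Gfmaj g * q2_ ^+ Gfmaj g^-1%g
          * a1_ ^+ Gcol g * a2_ ^+ Gcol g^-1%g)
      / ((1 - t1_) * (1 - t2_)
         * (1 - t1_ * q1_ ^+ (n * rs)) * (1 - t2_ * q2_ ^+ (n * rs))
         * \prod_(1 <= j < n)
             ((1 - t1_ ^+ s * q1_ ^+ (j * r)) * (1 - t2_ ^+ s * q2_ ^+ (j * r))))).
Proof.
move=> d rs; apply: (is_gf_unique (is_gf_lhs r p s)).
(* The index n on the right is the length of the list, so forgetting it loses nothing. *)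
apply: (is_gf_bij (phi := snd) _ _ _ _ (is_gf_fps_sum (D := [set n | (d %| n)%N]%classic)
  (A := words_of_size r p s) (w := fun _ x => word_weight r s x.1 x.2)
  (kappa := fun m : 'X_{1..7} => m var_u) _ _)).
- by move=> [n x] /= [dn [xS -> ->]]; rewrite dn.
- by move=> [n x] [n' x'] /= [_ [_ <- _]] [_ [_ <- _]] ->.
- move=> x [xS /andP[dn pS]]; exists (size x.2.2, x) => //.
- by [].
- move=> n dn; case: (posnP n) => [->|n0]; last first.
    exact: (is_gf_size_pos hr hs hsr hpr n0 dn).
  rewrite expr0 mul1r; exact: is_gf_size0.
- by move=> n x [_ <- _]; exact: word_weight_u.
Qed.
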